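(* Let $\nu$ be a computable probability measure on Cantor space $2^{\mathbb{N}}$ with full support. Then $\mathsf{MLR}^{\nu}= \mathsf{MR}^{\nu}_1(\ll_{kl}, \mathscr{F}_{n+1},D)$ and $\mathsf{SR}^{\nu}= \mathsf{MR}^{\nu}_1(\ll_{klc}, \mathscr{F}_{n+1},D)$.
   Context: A probability measure $\nu$ on Cantor space is identified with the function $\sigma\mapsto\nu(\sigma):=\nu([\sigma])$ on $2^{<\mathbb{N}}$, where $[\sigma]$ is the set of $\omega\in 2^{\mathbb{N}}$ extending $\sigma$. It is computable if the reals $\nu(\sigma)$ are computable uniformly in $\sigma$; it has full support if $\nu(\sigma)>0$ for all $\sigma$. $\omega\upharpoonright n$ is the length-$n$ initial segment of $\omega$. $\mathscr{F}_n$ is the $\sigma$-algebra generated by the sets $[\sigma]$ with $|\sigma|=n$, and $\nu(A\mid\mathscr{F}_n)(\omega):=\nu(A\mid[\omega\upharpoonright n])$. Kullback-Leibler divergence: for probability measures $P\ll Q$ on a $\sigma$-algebra $\mathscr{G}$, $D(P\mid Q)=\mathbb{E}_P[\ln \frac{dP}{dQ}]$. For $\nu,\mu$ with full support, $D_{\mathscr{F}_{n+1}}(\nu\mid\mu)(\omega)$ denotes $D(P\mid Q)$ where $P,Q$ are the restrictions to $\mathscr{F}_{n+1}$ of $\nu(\cdot\mid[\omega\upharpoonright n])$ and $\mu(\cdot\mid[\omega\upharpoonright n])$, respectively. For probability measures $\nu,\mu$ with full support: $\nu\ll_{kl}\mu$ iff $\sup_n \mathbb{E}_{\nu}\ln\frac{\nu(\cdot\upharpoonright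 n)}{\mu(\cdot\upharpoonright n)}$ (expectation of $\omega\mapsto \ln\frac{\nu(\omega\upharpoonright n)}{\mu(\omega\upharpoonright n)}$) is finite; $\nu\ll_{klc}\mu$ iff this supremum is finite and is a computable real. For a relation $\preceq$, $\mathsf{MR}^{\nu}_1(\preceq,\mathscr{F}_{n+1},D)$ is the set of $\omega\in 2^{\mathbb{N}}$ such that for all computable probability measures $\mu$ with full support and $\nu\preceq\mu$, one has $\sum_n D_{\mathscr{F}_{n+1}}(\nu\mid\mu)(\omega)<\infty$. A c.e. open set is one of the form $\bigcup_n[\sigma_n]$ for a computable sequence $\sigma_n$ of binary strings. $\mathsf{MLR}^{\nu}$ (Martin-Löf $\nu$-random points) is the set of $\omega$ such that $\omega\notin\bigcap_n U_n$ for every computable sequence $U_n$ of c.e. opens with $\nu(U_n)\le 2^{-n}$ for all $n\ge 0$. $\mathsf{SR}^{\nu}$ (Schnorr $\nu$-random points) is defined in the same way but restricting to sequences for which in addition $\nu(U_n)$ is computable uniformly in $n$. *)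

(* Defs.v *)
From HB Require Import structures.
From mathcomp Require Import all_boot all_order all_algebra.
From mathcomp Require Import all_classical all_reals all_analysis.

Set Implicit Arguments.
Unset Strict Implicit.
Unset Printing Implicit Defensive.

Import Order.TTheory GRing.Theory Num.Theory.
Import numFieldNormedType.Exports.

Local Open Scope classical_set_scope.
Local Open Scope ring_scope.

(* Kleene's partial recursive functions; [prec k] is the syntax for arity k. *)

Inductive prec : nat -> Type :=
| Zero k : prec k
| Succ : prec 1
| Proj k (i : 'I_k) : prec k
| Comp k m (f : prec m) (gs : 'I_m -> prec k) : prec k
| PRec k (f : prec k) (g : prec k.+2) : prec k.+1
| Mu k (f : prec k.+1) : prec k.

(* [eval p v y]: the computation of [p] on the input [v] halts with value [y].
   In [PRec f g] the recursion is on the first argument, and [g] receives the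
   counter, the previous value and the remaining arguments, in this order.
   In [Mu f] the minimized argument is the first one. *)
Fixpoint eval k (p : prec k) : k.-tuple nat -> nat -> Prop :=
  match p in prec k return k.-tuple nat -> nat -> Prop with
  | Zero _ => fun _ y => y = 0%N
  | Succ => fun v y => y = (thead v).+1
  | Proj _ i => fun v y => y = tnth v i
  | Comp _ m f gs => fun v y => exists w : m.-tuple nat,
      (forall i, eval (gs i) v (tnth w i)) /\ eval f w y
  | PRec _ f g => fun v y => exists h : nat -> nat,
      [/\ eval f [tuple of behead v] (h 0%N),
          forall i, (i < thead v)%N ->
            eval g [tuple of [:: i, h i & behead v]] (h i.+1)
        & y = h (thead v)]
  | Mu _ f => fun v y =>
      eval f [tuple of y :: v] 0%N /\
      forall i, (i < y)%N -> exists z, eval f [tuple of i :: v] z.+1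
  end.

Definition computable2 (f : nat -> nat -> nat) : Prop :=
  exists p : prec 2, forall x y, eval p [tuple x; y] (f x y).

(* The length-lexicographic numbering, a bijection from binary strings to
   natural numbers: 0 is the code of the empty string, and 2c+1 and 2c+2 are the
   codes of s0 and s1 if c is the code of s. *)
Definition str_code (s : seq bool) : nat :=
  foldl (fun (c : nat) (b : bool) => (c.*2 + b).+1) 0%N s.

(* [x] is a family of uniformly computable reals (where [code] numbers the index
   set): there are rational approximations to within 2^-n, with numerators and
   denominators computable from the index and from [n]. *)
Definition computable_reals (R : realType) (I : Type) (code : I -> nat)
    (x : I -> R) : Prop :=
  exists a b c : nat -> nat -> nat,
    [/\ computable2 a, computable2 b, computable2 c
      & forall i n,
          `|x i - ((a (code i) n)%:R - (b (code i) n)%:R)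
                    / (c (code i) n).+1%:R| <= 2 ^- n].

Definition computable_real (R : realType) (x : R) : Prop :=
  computable_reals id (fun _ : nat => x).

Definition cantor := g_sigma_algebraType (@open cantor_space).
HB.instance Definition _ := Measurable.on cantor.

Definition initseg (w : cantor) (n : nat) : seq bool := mkseq w n.

Definition cyl (s : seq bool) : set cantor := [set w | initseg w (size s) = s].

Lemma open_cyl (s : seq bool) : @open cantor_space (cyl s).
Proof.
have -> : cyl s = \bigcap_(i in `I_(size s))
    ((fun w : cantor_space => w i) @^-1` [set nth false s i]).
  apply/seteqP; split => w /=.
    move=> ws i /= si; have := congr1 (fun t => nth false t i) ws.
    by rewrite nth_mkseq.
  move=> h; apply: (@eq_from_nth _ false); first by rewrite size_mkseq.
  by move=> i; rewrite size_mkseq => si; rewrite nth_mkseq // (h i si).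
rewrite bigcap_mkord; apply: big_ind; [exact: openT|exact: openI|move=> i _].
have pc : continuous (fun w : cantor_space => w i).
  exact: (@proj_continuous nat (fun=> bool) i).
apply: (proj1 (continuousP _) pc); exact: discrete_open.
Qed.

Lemma measurable_cyl (s : seq bool) : measurable (cyl s).
Proof. by apply: sub_sigma_algebra; exact: open_cyl. Qed.

Definition cyls (n : nat) : set (set cantor) := cyl @` [set s | size s = n].

(* Cantor space with the sigma-algebra F_n *)
Definition Fspace (n : nat) := g_sigma_algebraType (cyls n).
HB.instance Definition _ n := Measurable.on (Fspace n).

Definition toF (n : nat) (w : cantor) : Fspace n := w.

Lemma measurable_toF n : measurable_fun [set: cantor] (toF n).
Proof.
move=> _ A mA; rewrite setTI.
suff : <<s cyls n >> `<=` (measurable : set (set cantor)) by apply.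
apply: smallest_sub; first exact: sigma_algebra_measurable.
by move=> _ [s _ <-]; exact: measurable_cyl.
Qed.

HB.instance Definition _ n :=
  isMeasurableFun.Build _ _ _ _ (toF n) (@measurable_toF n).

Section divergence.
Context (R : realType).
Local Open Scope ereal_scope.

(* Only meaningful if P is absolutely continuous with respect to Q. *)
Definition KL d (T : measurableType d) (P Q : probability T R) : \bar R :=
  'E_P[fun w => ln (fine (Radon_Nikodym (charge_of_finite_measure P) Q w))].

Implicit Types (nu mu : probability cantor R).

(* The measure nu( . | [s]); it is nu itself in the degenerate case
   nu [s] = 0. *)
Definition condp nu (s : seq bool) : probability cantor R :=
  mnormalize (mrestr nu (measurable_cyl s)) nu.

Definition restrF n nu : probability (Fspace n) R := distribution nu (toF n).

(* D_{F_{n+1}}(nu | mu)(w) *)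
Definition condKL n nu mu (w : cantor) : \bar R :=
  KL (restrF n.+1 (condp nu (initseg w n)))
     (restrF n.+1 (condp mu (initseg w n))).

Definition full_support nu : Prop := forall s, 0 < nu (cyl s).

Definition computable_measure nu : Prop :=
  computable_reals str_code (fun s => fine (nu (cyl s))).

Definition sup_KL nu mu : \bar R :=
  ereal_sup (range (fun n : nat =>
    'E_nu[fun w => ln (fine (nu (cyl (initseg w n)))
                       / fine (mu (cyl (initseg w n))))%R])).

Definition ll_kl nu mu : Prop := sup_KL nu mu \is a fin_num.

Definition ll_klc nu mu : Prop :=
  sup_KL nu mu \is a fin_num /\ computable_real (fine (sup_KL nu mu)).

Definition MR1 (ll : probability cantor R -> probability cantor R -> Prop) nu
    : set cantor :=
  [set w | forall mu, computable_measure mu -> full_support mu -> ll nu mu ->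
     \sum_(0 <= n <oo) condKL n nu mu w < +oo].

(* U is a computable sequence of c.e. open sets. *)
Definition ce_opens (U : nat -> set cantor) : Prop :=
  exists s : nat -> nat -> seq bool,
    computable2 (fun n m => str_code (s n m)) /\
    forall n, U n = \bigcup_m cyl (s n m).

Definition MLR nu : set cantor :=
  [set w | forall U : nat -> set cantor, ce_opens U ->
     (forall n, nu (U n) <= (2 ^- n)%:E) -> ~ (\bigcap_n U n) w].

Definition SR nu : set cantor :=
  [set w | forall U : nat -> set cantor, ce_opens U ->
     (forall n, nu (U n) <= (2 ^- n)%:E) ->
     computable_reals id (fun n => fine (nu (U n))) -> ~ (\bigcap_n U n) w].

End divergence.

(* Main.v *)
(* By the chain rule, the expectation under nu of ln (nu(w|n) / mu(w|n)) is the
   expectation of the sum over k < n of the conditional divergences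
   D_(F_(k+1))(nu | mu), which are nonnegative.  So if nu <<_kl mu, the sum f of
   all of them has finite expectation, and the sets {f > 2^(n+c)} form a
   Martin-Löf test by Markov's inequality.  If moreover the expectation of f is
   computable, one finds levels n_j beyond which f has expectation at most 4^-j;
   the clopen sets on which f grows by more than 2^-j between the levels n_j and
   n_(j+1) then yield a Schnorr test.

   Conversely, given a test (U_i), let e_k(w) be the number of i < k such that w
   has been seen to lie in U_i by stage k.  The measure mu has the same
   transition probabilities as nu, except at the strings where e_k has just
   increased; there the probability p of a 1 is replaced by p 2^-N, with N p
   between 6 and 10, which costs a divergence between 2 and 10.  Hence the sum of
   the divergences is infinite on the intersection of the U_i, while its
   expectation is at most 10 times the sum of the nu(U_i), and the same estimate
   for the tails makes it computable when the nu(U_i) are. *)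

From HB Require Import structures.
From mathcomp Require Import all_boot all_order all_algebra.
From mathcomp Require Import all_classical all_reals all_analysis.
From mathcomp Require Import measurable_realfun.
From mathcomp Require Import zify ring lra.
Require Import Defs.

Set Implicit Arguments.
Unset Strict Implicit.
Unset Printing Implicit Defensive.

(** * Computable functions *)

(** The order of computable reals is undecidable, and this shapes both directions. A real is only
    ever compared with a threshold up to a gap, so every test set is defined by an approximate
    inequality, and the constants leave room for a factor 4. The sets {f > 2^(n+c)} do not serve for
    Schnorr tests, as their measures need not be computable. The growth of the sum between two fixed
    levels depends on finitely many bits, so the measure of a condition on it is a finite sum of
    computable reals. In the converse direction, a fixed change of the transition probability [p]
    would cost almost nothing where [p] is small. Replacing [p] by [p 2^-N] costs about [N p ln 2],
    which can be kept between fixed bounds for every [p] and leaves full support intact. Whether a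
    string is modified is decided from the string alone, which keeps the new measure computable.
    Analytically everything is reduced to finite sums over strings of one length: the sigma-algebras
    F_n have finitely many atoms, and since the divergences are nonnegative, their summability at a
    point is boundedness along its prefixes. *)

Definition recf k (f : k.-tuple nat -> nat) :=
  exists p : prec k, forall v, eval p v (f v).

Lemma recf_proj k (i : 'I_k) : recf (fun v => tnth v i).
Proof. by exists (Proj i). Qed.

Definition computable1 (f : nat -> nat) :=
  exists p : prec 1, forall x, eval p [tuple x] (f x).

Lemma recf_op1 k (h : nat -> nat) (f : k.-tuple nat -> nat) :
  computable1 h -> recf f -> recf (fun v => h (f v)).
Proof.
move=> [p ph] [q qf]; exists (Comp p (fun _ : 'I_1 => q)) => v /=.
exists [tuple f v]; split; last exact: ph.
by move=> i; rewrite (ord1 i) (tnth_nth 0); exact: qf.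
Qed.

Lemma recf_op2 k (h : nat -> nat -> nat) (f g : k.-tuple nat -> nat) :
  computable2 h -> recf f -> recf g -> recf (fun v => h (f v) (g v)).
Proof.
move=> [p ph] [q qf] [r rg].
exists (Comp p (fun i : 'I_2 => if val i is 0 then q else r)) => v /=.
exists [tuple f v; g v]; split; last exact: ph.
by move=> [[|[|//]] ?]; rewrite (tnth_nth 0) /=.
Qed.

Lemma computable1_recf f :
  computable1 f <-> recf (fun v : 1.-tuple nat => f (thead v)).
Proof.
split=> [[p pf]|[p pf]]; exists p; last by move=> x; exact: (pf [tuple x]).
move=> v; have := pf (thead v); congr (eval _ _ _); apply/val_inj.
by case/tupleP: v => x v; rewrite (tuple0 v) /= theadE.
Qed.

Lemma computable2_recf f :
  computable2 f <->
  recf (fun v : 2.-tuple nat => f (thead v) (tnth v (@Ordinal 2 1 isT))).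
Proof.
split=> [[p pf]|[p pf]]; exists p; last by move=> x y; exact: (pf [tuple x; y]).
move=> v; have := pf (thead v) (tnth v (@Ordinal 2 1 isT)).
congr (eval _ _ _); apply/val_inj.
by case/tupleP: v => x v; case/tupleP: v => y v; rewrite (tuple0 v).
Qed.

Lemma computable1_id : computable1 id.
Proof. by exists (Proj ord0) => x. Qed.

Lemma computable1S : computable1 succn.
Proof. by exists Succ => x. Qed.

Lemma computable1_comp g f : computable1 g -> computable1 f -> computable1 (g \o f).
Proof. by move=> cg /computable1_recf cf; apply/computable1_recf;
  exact: (recf_op1 cg cf). Qed.

Lemma computable1_cst c : computable1 (fun=> c).
Proof.
elim: c => [|c ih]; first by exists (Zero 1).
exact: (computable1_comp computable1S ih).
Qed.

Lemma computable1_op2 h f g : computable2 h -> computable1 f -> computable1 g ->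
  computable1 (fun x => h (f x) (g x)).
Proof.
move=> ch /computable1_recf cf /computable1_recf cg; apply/computable1_recf.
exact: (recf_op2 ch cf cg).
Qed.

Lemma computable2_comp (h f g : nat -> nat -> nat) :
  computable2 h -> computable2 f -> computable2 g ->
  computable2 (fun x y => h (f x y) (g x y)).
Proof.
move=> ch /computable2_recf cf /computable2_recf cg; apply/computable2_recf.
exact: (recf_op2 ch cf cg).
Qed.

Lemma computable2_comp1 (h : nat -> nat) (f : nat -> nat -> nat) :
  computable1 h -> computable2 f -> computable2 (fun x y => h (f x y)).
Proof.
move=> ch /computable2_recf cf; apply/computable2_recf; exact: (recf_op1 ch cf).
Qed.

Lemma computable2_fst : computable2 (fun x _ => x).
Proof. by apply/computable2_recf; exact: (recf_proj ord0). Qed.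

Lemma computable2_snd : computable2 (fun _ y => y).
Proof. by apply/computable2_recf; exact: recf_proj. Qed.

Lemma computable2_rec (f : nat -> nat) (g : nat -> nat -> nat -> nat) :
  computable1 f ->
  recf (fun v : 3.-tuple nat => g (tnth v (@Ordinal 3 0 isT))
    (tnth v (@Ordinal 3 1 isT)) (tnth v (@Ordinal 3 2 isT))) ->
  computable2 (fun n a => nat_rect (fun=> nat) (f a) (fun i h => g i h a) n).
Proof.
move=> [p pf] [q qg]; exists (PRec p q) => n a /=.
exists (fun n => nat_rect (fun=> nat) (f a) (fun i h => g i h a) n); split=> //.
by have := pf a; congr (eval _ _ _); exact/val_inj.
Qed.

Lemma computable2_mu (P : nat -> nat -> nat) (m : nat -> nat) :
  computable2 P -> (forall x, P (m x) x = 0) ->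
  (forall x i, i < m x -> P i x != 0) -> computable1 m.
Proof.
move=> [p pP] m0 mmin; exists (Mu p) => x /=; split.
  by have := pP (m x) x; rewrite m0; congr (eval _ _ _); exact/val_inj.
move=> i im; exists (P i x).-1; have := pP i x.
rewrite prednK ?lt0n ?mmin //; congr (eval _ _ _); exact/val_inj.
Qed.

Lemma computable2C f : computable2 f -> computable2 (fun x y => f y x).
Proof.
by move=> cf; exact: (computable2_comp cf computable2_snd computable2_fst).
Qed.

Lemma computable2_add : computable2 addn.
Proof.
have : computable2 (fun n a => nat_rect (fun=> nat) (id a) (fun i h => h.+1) n).
  apply: (computable2_rec (f := id)); first exact: computable1_id.
  by apply: recf_op1; [exact: computable1S|exact: recf_proj].
congr computable2; apply/funext => n; apply/funext => a.
by elim: n => //= n ->.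
Qed.

Lemma computable2_mul : computable2 muln.
Proof.
have : computable2 (fun n a => nat_rect (fun=> nat) ((fun=> 0) a) (fun i h => h +
  a) n).
  apply: (computable2_rec (f := fun=> 0)); first exact: computable1_cst.
  apply: recf_op2; [exact: computable2_add|exact: recf_proj..].
congr computable2; apply/funext => n; apply/funext => a.
by elim: n => //= n ->; rewrite mulSn addnC.
Qed.

Lemma computable1_pred : computable1 predn.
Proof.
have /computable1_op2 : computable2 (fun n a => nat_rect (fun=> nat) ((fun=> 0)
  a) (fun i h => i) n).
  apply: (computable2_rec (f := fun=> 0)); first exact: computable1_cst.
  exact: recf_proj.
move=> /(_ id id computable1_id computable1_id).
by congr computable1; apply/funext => -[].
Qed.

Lemma computable2_sub : computable2 subn.
Proof.
have /computable2C : computable2 (fun n a => nat_rect (fun=> nat) (id a) (fun i h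
  => h.-1) n).
  apply: (computable2_rec (f := id)); first exact: computable1_id.
  by apply: recf_op1; [exact: computable1_pred|exact: recf_proj].
congr computable2; apply/funext => n; apply/funext => a.
by elim: a => /= [|a ->]; rewrite ?subn0 ?subnS.
Qed.

(* Injective but not surjective; [a] and [b] are recovered from the integer
   square root, which is [a + b]. *)
Definition cpair (a b : nat) : nat := (a + b) * (a + b) + a.

Lemma sqrt_subproof n : exists s, n < s.+1 * s.+1.
Proof. by exists n; lia. Qed.

Definition isqrt n := ex_minn (sqrt_subproof n).
Definition cpair1 n := n - isqrt n * isqrt n.
Definition cpair2 n := isqrt n - cpair1 n.

Lemma isqrt_cpair a b : isqrt (cpair a b) = a + b.
Proof.
rewrite /isqrt; case: ex_minnP => m m1 m2; rewrite /cpair in m1 m2.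
have := m2 (a + b); nia.
Qed.

Lemma cpair1K a b : cpair1 (cpair a b) = a.
Proof. by rewrite /cpair1 isqrt_cpair /cpair addKn. Qed.

Lemma cpair2K a b : cpair2 (cpair a b) = b.
Proof. by rewrite /cpair2 cpair1K isqrt_cpair addKn. Qed.

Lemma computable2_cpair : computable2 cpair.
Proof.
have ca := computable2_add.
apply: (computable2_comp ca) computable2_fst.
exact: (computable2_comp computable2_mul).
Qed.

Lemma computable1_isqrt : computable1 isqrt.
Proof.
apply: (@computable2_mu (fun s n => n.+1 - s.+1 * s.+1)).
- apply: (computable2_comp computable2_sub).
    exact: (computable2_comp1 computable1S computable2_snd).
  by apply: (computable2_comp computable2_mul);
    exact: (computable2_comp1 computable1S computable2_fst).
- by move=> n; rewrite /isqrt; case: ex_minnP => m m1 _; apply/eqP;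
  rewrite subn_eq0.
- move=> n i; rewrite /isqrt; case: ex_minnP => m _ mmin im; rewrite subn_eq0.
  by apply/negP => h; have := mmin _ h; rewrite leqNgt im.
Qed.

Lemma computable1_cpair1 : computable1 cpair1.
Proof.
apply: (computable1_op2 computable2_sub computable1_id).
by apply: (computable1_op2 computable2_mul); exact: computable1_isqrt.
Qed.

Lemma computable1_cpair2 : computable1 cpair2.
Proof.
exact: (computable1_op2 computable2_sub computable1_isqrt computable1_cpair1).
Qed.

(** * Computable maps between encoded types *)

Class encodable (T : Type) := enc : T -> nat.

#[global] Instance nat_encodable : encodable nat := id.
#[global] Instance bool_encodable : encodable bool := nat_of_bool.
#[global] Instance prod_encodable A B (eA : encodable A) (eB : encodable B) :
  encodable (A * B) := fun x => cpair (enc x.1) (enc x.2).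
#[global] Instance str_encodable : encodable (seq bool) := str_code.

(* The program need only halt on codes: minimization would not be total on
   arbitrary numbers. *)
Definition cfun A B (eA : encodable A) (eB : encodable B) (f : A -> B) :=
  exists p : prec 1, forall a, eval p [tuple enc a] (enc (f a)).
Arguments cfun {A B eA eB} f.

Lemma eval_comp1 k (q : prec 1) (r : prec k) v y z :
  eval r v y -> eval q [tuple y] z -> eval (Comp q (fun _ : 'I_1 => r)) v z.
Proof.
move=> ry qz /=; exists [tuple y]; split=> // i.
by rewrite (ord1 i) (tnth_nth 0).
Qed.

Definition comp2 k (q : prec 2) (r s : prec k) : prec k :=
  Comp q (fun i : 'I_2 => if val i is 0 then r else s).

Lemma eval_comp2 k (q : prec 2) (r s : prec k) v x y z :
  eval r v x -> eval s v y -> eval q [tuple x; y] z -> eval (comp2 q r s) v z.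
Proof.
move=> rx sy qz /=; exists [tuple x; y]; split=> //.
by move=> [[|[|//]] ?]; rewrite (tnth_nth 0).
Qed.

Section closure.
Context A B C D (eA : encodable A) (eB : encodable B) (eC : encodable C)
  (eD : encodable D).

Lemma eq_cfun (f g : A -> B) : f =1 g -> cfun f -> cfun g.
Proof. by move=> fg [p pf]; exists p => a; rewrite -fg. Qed.

Lemma cf_id : cfun (fun x : A => x).
Proof. by exists (Proj ord0) => a /=. Qed.

Lemma cf_cst (b : B) : cfun (fun _ : A => b).
Proof. by have [p pb] := computable1_cst (enc b); exists p. Qed.

Lemma cf_comp (g : B -> C) (f : A -> B) : cfun g -> cfun f -> cfun (fun x => g (f
  x)).
Proof.
move=> [p pg] [q qf]; exists (Comp p (fun _ : 'I_1 => q)) => a.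
exact: (eval_comp1 (qf a)).
Qed.

(** With [h] the identity this is a change of type: [strn], [str_code] and the inclusion of the
    booleans into the numbers leave codes unchanged. *)
Lemma cf_code1 (h : nat -> nat) (f : A -> B) (g : A -> C) :
  computable1 h -> (forall a, enc (g a) = h (enc (f a))) -> cfun f -> cfun g.
Proof.
move=> [p ph] gE [q qf]; exists (Comp p (fun _ : 'I_1 => q)) => a.
by apply: (eval_comp1 (qf a)); rewrite gE.
Qed.

Lemma cf_code2 (h : nat -> nat -> nat) (f : A -> B) (g : A -> C) (k : A -> D) :
  computable2 h -> (forall a, enc (k a) = h (enc (f a)) (enc (g a))) ->
  cfun f -> cfun g -> cfun k.
Proof.
move=> [p ph] kE [q qf] [r rg]; exists (comp2 p q r) => a.
by apply: (eval_comp2 (qf a) (rg a)); rewrite kE.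
Qed.

End closure.

Section closure2.
Context A B C D (eA : encodable A) (eB : encodable B) (eC : encodable C)
  (eD : encodable D).

Lemma cf_pair (f : A -> B) (g : A -> C) : cfun f -> cfun g -> cfun (fun x => (f
  x, g x)).
Proof. exact: (cf_code2 computable2_cpair). Qed.

Lemma cf_fst (f : A -> B * C) : cfun f -> cfun (fun x => (f x).1).
Proof.
by apply: (cf_code1 computable1_cpair1) => a; rewrite {2}/enc /= cpair1K.
Qed.

Lemma cf_snd (f : A -> B * C) : cfun f -> cfun (fun x => (f x).2).
Proof.
by apply: (cf_code1 computable1_cpair2) => a; rewrite {2}/enc /= cpair2K.
Qed.

Lemma cf_rec (f : A -> B) (g : A -> nat -> B -> B) (n : A -> nat) :
  cfun f -> cfun (fun t : A * nat * B => g t.1.1 t.1.2 t.2) -> cfun n ->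
  cfun (fun a => nat_rect (fun=> B) (f a) (g a) (n a)).
Proof.
move=> [p pf] [q qg] [r rn].
have [c cE] := computable2_cpair.
pose v i := Proj i : prec 3.
(* [PRec] passes the counter, the value and the parameter in this order; [t] packs them into the
   code of the triple [(a, i, value)], the kind of input on which [q] is known to halt. *)
pose t := comp2 c (comp2 c (v (@Ordinal 3 2 isT)) (v (@Ordinal 3 0 isT)))
  (v (@Ordinal 3 1 isT)).
exists (comp2 (PRec p (Comp q (fun _ : 'I_1 => t))) r (Proj ord0)) => a.
apply: (eval_comp2 (rn a)); first by [].
exists (fun n => enc (nat_rect (fun=> B) (f a) (g a) n)); split=> //.
  by have := pf a; congr (eval _ _ _); exact/val_inj.
move=> i _; apply: (eval_comp1 (y := enc (a, i, nat_rect (fun=> B) (f a) (g a) i))).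
  by apply: eval_comp2 (cE _ _) => //; apply: eval_comp2 (cE _ _).
exact: (qg (a, i, nat_rect (fun=> B) (f a) (g a) i)).
Qed.

End closure2.

Section closure3.
Context A B C D (eA : encodable A) (eB : encodable B) (eC : encodable C)
  (eD : encodable D).

Lemma cf_op2 (h : B -> C -> D) (f : A -> B) (g : A -> C) :
  cfun (fun t : B * C => h t.1 t.2) -> cfun f -> cfun g ->
  cfun (fun x => h (f x) (g x)).
Proof.
by move=> ch cf cg; exact: (cf_comp (g := fun t => h t.1 t.2) ch (cf_pair cf cg)).
Qed.

End closure3.

Section closure4.
Context A B (eA : encodable A) (eB : encodable B).

Lemma cf_iter (f : A -> B) (g : A -> B -> B) (n : A -> nat) :
  cfun f -> cfun (fun t : A * B => g t.1 t.2) -> cfun n ->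
  cfun (fun a => iter (n a) (g a) (f a)).
Proof.
move=> cf cg cn.
apply: (@eq_cfun _ _ _ _ (fun a => nat_rect (fun=> B) (f a) (fun=> g a) (n a))).
  by move=> a; elim: (n a) => //= k ->.
apply: (cf_rec cf _ cn).
apply: (cf_op2 (h := g)) cg _ (cf_snd (cf_id _)).
exact: (cf_fst (cf_fst (cf_id _))).
Qed.

End closure4.

Section arith.
Context A (eA : encodable A).
Implicit Types f g : A -> nat.
Implicit Types p q : A -> bool.

Lemma cf_S f : cfun f -> cfun (fun x => (f x).+1).
Proof. exact: (cf_code1 computable1S). Qed.

Lemma cf_pred f : cfun f -> cfun (fun x => (f x).-1).
Proof. exact: (cf_code1 computable1_pred). Qed.

Lemma cf_add f g : cfun f -> cfun g -> cfun (fun x => f x + g x).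
Proof. exact: (cf_code2 computable2_add). Qed.

Lemma cf_sub f g : cfun f -> cfun g -> cfun (fun x => f x - g x).
Proof. exact: (cf_code2 computable2_sub). Qed.

Lemma cf_mul f g : cfun f -> cfun g -> cfun (fun x => f x * g x).
Proof. exact: (cf_code2 computable2_mul). Qed.

Lemma cf_eq0 f : cfun f -> cfun (fun x => f x == 0).
Proof.
apply: (cf_code1 (h := fun n => 1 - n)).
  by apply: (computable1_op2 computable2_sub);
    [exact: computable1_cst|exact: computable1_id].
by move=> a; rewrite /enc /nat_encodable/bool_encodable /=; case: (f a) => // n;
  lia.
Qed.

Lemma cf_leq f g : cfun f -> cfun g -> cfun (fun x => f x <= g x).
Proof. by move=> cf cg; apply: cf_eq0; exact: cf_sub. Qed.

Lemma cf_ltn f g : cfun f -> cfun g -> cfun (fun x => f x < g x).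
Proof. by move=> cf cg; apply: cf_leq => //; exact: cf_S. Qed.

Lemma cf_negb p : cfun p -> cfun (fun x => ~~ p x).
Proof.
apply: (cf_code1 (h := fun n => 1 - n)).
  by apply: (computable1_op2 computable2_sub);
    [exact: computable1_cst|exact: computable1_id].
by move=> a; rewrite /enc /bool_encodable; case: (p a).
Qed.

Lemma cf_and p q : cfun p -> cfun q -> cfun (fun x => p x && q x).
Proof.
by apply: (cf_code2 computable2_mul) => a; rewrite /enc /bool_encodable mulnb.
Qed.

Lemma cf_or p q : cfun p -> cfun q -> cfun (fun x => p x || q x).
Proof.
move=> cp cq; apply: (@eq_cfun _ _ _ _ (fun x => ~~ (~~ p x && ~~ q x))).
  by move=> x; rewrite negb_and !negbK.
by apply: cf_negb; apply: cf_and; exact: cf_negb.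
Qed.

Lemma cf_eqn f g : cfun f -> cfun g -> cfun (fun x => f x == g x).
Proof.
move=> cf cg; apply: (@eq_cfun _ _ _ _ (fun x => (f x <= g x) && (g x <= f x))).
  by move=> x; rewrite eqn_leq.
by apply: cf_and; exact: cf_leq.
Qed.

Lemma cf_nat p : cfun p -> cfun (fun x => p x : nat).
Proof. exact: (cf_code1 computable1_id). Qed.

End arith.

Section control.
Context A B (eA : encodable A) (eB : encodable B).

(** Both branches are total, so both are evaluated, and their codes are multiplied by the truth
    values of [p] and of its negation and added. *)
Lemma cf_if (p : A -> bool) (f g : A -> B) : cfun p -> cfun f -> cfun g ->
  cfun (fun x => if p x then f x else g x).
Proof.
move=> [c cp] [q qf] [r rg].
have cN : cfun (fun x => (p x : nat) * enc (f x) + (~~ p x : nat) * enc (g x)).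
  apply: cf_add; apply: cf_mul; first by apply: cf_nat; exists c.
  - by exists q.
  - by apply: cf_nat; apply: cf_negb; exists c.
  - by exists r.
apply: (cf_code1 computable1_id _ cN) => a.
by rewrite /enc/nat_encodable /=; case: (p a);
  rewrite /= ?mul1n ?mul0n ?addn0 ?add0n.
Qed.

Lemma cf_mu (P : A -> nat -> bool) : cfun (fun t => P t.1 t.2) ->
  (forall a, exists n, P a n) ->
  exists m : A -> nat, cfun m /\ forall a, P a (m a) /\ forall i, P a i -> m a <= i.
Proof.
move=> [p pP] exP.
exists (fun a => ex_minn (exP a)); split; last first.
  by move=> a; case: ex_minnP => m Pm mmin; split.
have [c cE] := computable2_cpair.
have [n nE] : computable1 (fun n => 1 - n).
  by apply: (computable1_op2 computable2_sub);
    [exact: computable1_cst|exact: computable1_id].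
pose t := comp2 c (Proj (@Ordinal 2 1 isT)) (Proj (@Ordinal 2 0 isT)).
(* [Mu] looks for a zero, hence [1 - P]. *)
have tP a i : eval (Comp n (fun _ : 'I_1 => Comp p (fun _ : 'I_1 => t)))
    [tuple i; enc a] (1 - P a i).
  apply: eval_comp1 (nE _); apply: eval_comp1 (pP (a, i)).
  exact: eval_comp2 (cE _ _).
exists (Mu (Comp n (fun _ : 'I_1 => Comp p (fun _ : 'I_1 => t)))) => a.
case: ex_minnP => m Pm mmin; split.
  by have := tP a m; rewrite Pm; congr (eval _ _ _); exact/val_inj.
move=> i im; exists 0; have := tP a i.
have -> : P a i = false by apply/negP => /mmin; rewrite leqNgt => /negP; exact.
by congr (eval _ _ _); exact/val_inj.
Qed.

End control.

(** Syntax-directed proofs of computability: the head symbol of the body selects the closure lemma.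
    [computability_step] is redefined when new symbols become available. *)
Ltac computability_arith :=
  match goal with
  | |- cfun (fun x => x) => exact: cf_id
  | |- cfun (fun _ => ?b) => exact: cf_cst
  | |- cfun fst => exact: (cf_fst (cf_id _))
  | |- cfun snd => exact: (cf_snd (cf_id _))
  | |- cfun (fun x => fst (@?f x)) => apply (@cf_fst _ _ _ _ _ _ f)
  | |- cfun (fun x => snd (@?f x)) => apply (@cf_snd _ _ _ _ _ _ f)
  | |- cfun (fun x => (@?f x, @?g x)) => apply (@cf_pair _ _ _ _ _ _ f g)
  | |- cfun (fun x => succn (@?f x)) => apply (@cf_S _ _ f)
  | |- cfun (fun x => predn (@?f x)) => apply (@cf_pred _ _ f)
  | |- cfun (fun x => addn (@?f x) (@?g x)) => apply (@cf_add _ _ f g)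
  | |- cfun (fun x => subn (@?f x) (@?g x)) => apply (@cf_sub _ _ f g)
  | |- cfun (fun x => muln (@?f x) (@?g x)) => apply (@cf_mul _ _ f g)
  | |- cfun (fun x => leq (@?f x) (@?g x)) => apply (@cf_leq _ _ f g)
  | |- cfun (fun x => negb (@?f x)) => apply (@cf_negb _ _ f)
  | |- cfun (fun x => andb (@?f x) (@?g x)) => apply (@cf_and _ _ f g)
  | |- cfun (fun x => orb (@?f x) (@?g x)) => apply (@cf_or _ _ f g)
  | |- cfun (fun x => @eq_op Datatypes_nat__canonical__eqtype_Equality (@?f x)
    (@?g x)) => apply (@cf_eqn _ _ f g)
  | |- cfun (fun x => if _ then _ else _) => apply: cf_if
  end.
Ltac computability_step := first [assumption | computability_arith].
Ltac computability := repeat computability_step.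

Section arith2.
Context A (eA : encodable A).

Lemma cf_expn (f g : A -> nat) : cfun f -> cfun g -> cfun (fun x => f x ^ g x).
Proof.
move=> cf cg.
apply: (@eq_cfun _ _ _ _ (fun x => iter (g x) (muln (f x)) 1)).
  by move=> x; elim: (g x) => //= n ->; rewrite expnS.
apply: (cf_iter (f := fun=> 1) (g := fun x => muln (f x))); [exact: cf_cst| |by []].
apply: cf_mul; last exact: cf_snd (cf_id _).
exact: cf_comp cf (cf_fst (cf_id _)).
Qed.

Lemma cf_sum (F : A -> nat -> nat) (n : A -> nat) :
  cfun (fun t => F t.1 t.2) -> cfun n -> cfun (fun x => \sum_(i < n x) F x i).
Proof.
move=> cF cn.
apply: (@eq_cfun _ _ _ _ (fun x => nat_rect (fun=> nat) ((fun=> 0) x) (fun i h =>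
  h + F x i) (n x))).
  by move=> x; elim: (n x) => /= [|k ->]; rewrite ?big_ord0 ?big_ord_recr.
apply: (cf_rec (f := fun=> 0) (g := fun x i h => h + F x i)) => //.
  exact: cf_cst.
computability; apply: (cf_op2 (h := F)) => //; computability.
Qed.

(** Counting the witnesses turns the bounded quantifier into a sum. *)
Lemma cf_has (P : A -> nat -> bool) (n : A -> nat) :
  cfun (fun t => P t.1 t.2) -> cfun n -> cfun (fun x => has (P x) (iota 0 (n x))).
Proof.
move=> cP cn.
apply: (@eq_cfun _ _ _ _ (fun x => 0 < \sum_(i < n x) (P x i : nat))).
  move=> x; rewrite has_count -sum1_count [in RHS]big_mkcond /=.
  rewrite -(big_mkord predT (fun i => nat_of_bool (P x i))) /index_iota subn0.
  by congr (0 < _); apply: eq_bigr => i _; case: (P x i).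
apply: cf_ltn; first exact: cf_cst.
by apply: (cf_sum (F := fun x i => P x i : nat)) => //; exact: cf_nat.
Qed.

Lemma cf_half (f : A -> nat) : cfun f -> cfun (fun x => (f x)./2).
Proof.
(* The half of [n] is the least [m] with [n < 2 (m + 1)]. *)
move=> cf; have [||m [cm mP]] := @cf_mu _ _ (fun n m => n < m.+1 + m.+1).
- computability.
- by move=> a; exists a; lia.
apply: (cf_comp (g := half)) cf; apply: eq_cfun cm => n.
have [h1 /(_ n./2) h2] := mP n; lia.
Qed.

End arith2.

Ltac computability_expn :=
  match goal with
  | |- cfun (fun x => expn (@?f x) (@?g x)) => apply (@cf_expn _ _ f g)
  | |- cfun (fun x => half (@?f x)) => apply (@cf_half _ _ f)
  | |- cfun (fun x => nat_of_bool (@?f x)) => apply (@cf_nat _ _ f)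
  end.
Ltac computability_step ::=
  first [assumption | computability_arith | computability_expn].

(** * Binary strings, their codes and their levels *)

Lemma str_code_rcons s b : str_code (rcons s b) = ((str_code s).*2 + b).+1.
Proof. by rewrite /str_code -cats1 foldl_cat. Qed.

Lemma str_code_inj : injective str_code.
Proof.
elim/last_ind => [|s b ih]; elim/last_ind => [|t c _] //;
  rewrite ?str_code_rcons //.
move=> h.
have bc : b = c by case: b c h => -[] //=; lia.
by rewrite bc (ih t) //; rewrite bc in h; lia.
Qed.

Lemma str_code_surj n : exists s, str_code s = n.
Proof.
have [m] := ubnP n; elim: m n => // m ih [|n] nm; first by exists [::].
have [|s sn] := ih n./2; first by lia.
exists (rcons s (odd n)); rewrite str_code_rcons sn.
by have := odd_double_half n; lia.
Qed.

(** The inverse of the numbering is obtained by choice. It is computable all the same, because on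
    codes it acts as the identity. *)
Definition strn n : seq bool := sval (cid (str_code_surj n)).

Lemma strnK : cancel strn str_code.
Proof. by move=> n; rewrite /strn; case: cid. Qed.

Lemma str_codeK : cancel str_code strn.
Proof. by move=> s; apply: str_code_inj; rewrite strnK. Qed.

Definition parent (s : seq bool) := take (size s).-1 s.

Lemma parent_rcons s b : parent (rcons s b) = s.
Proof. by rewrite /parent size_rcons /= -cats1 take_size_cat. Qed.

Lemma str_code_parent s : str_code (parent s) = (str_code s).-1./2.
Proof.
elim/last_ind: s => // s b _; rewrite parent_rcons str_code_rcons /=.
by case: b; lia.
Qed.

Lemma iter_parent n s : iter n parent s = take (size s - n) s.
Proof.
elim: n => [|n ih]; first by rewrite subn0 take_size.
rewrite /= ih /parent size_take_min take_takel; last by lia.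
by congr (take _ s); lia.
Qed.

Fixpoint strs n : seq (seq bool) :=
  if n is m.+1 then flatten [seq [:: rcons s false; rcons s true] | s <- strs m]
  else [:: [::]].

(** The strings of length [n] have consecutive codes from [2^n - 1] on, so that a sum over a level
    becomes a sum over an interval of numbers. *)
Lemma strs_code n : map str_code (strs n) = iota (2 ^ n).-1 (2 ^ n).
Proof.
have flat a m : flatten [seq [:: c.*2.+1;
  c.*2.+2] | c <- iota a m] = iota a.*2.+1 m.*2.
  by elim: m a => //= m ih a; rewrite ih doubleS.
elim: n => // n ih /=.
rewrite map_flatten -map_comp.
rewrite (@eq_map _ _ _ ((fun c => [:: c.*2.+1; c.*2.+2]) \o str_code)); last first.
  by move=> s /=; rewrite !str_code_rcons addn0 addn1.
rewrite map_comp ih flat expnS mul2n; congr iota.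
by have := expn_gt0 2 n; lia.
Qed.

Lemma strs_uniq n : uniq (strs n).
Proof. by rewrite -(map_inj_uniq str_code_inj) strs_code iota_uniq. Qed.

Lemma mem_strs n s : (s \in strs n) = (size s == n).
Proof.
elim: n s => [|n ih] s; first by rewrite inE size_eq0.
apply/flatten_mapP/eqP => [[t]|].
  by rewrite ih => /eqP tn; rewrite !inE => /orP[] /eqP ->; rewrite size_rcons tn.
elim/last_ind: s => // s b _; rewrite size_rcons => -[sn].
exists s; first by rewrite ih sn.
by rewrite !inE; case: b; rewrite eqxx ?orbT.
Qed.

Lemma strsE n : strs n = [seq strn ((2 ^ n).-1 + i) | i <- iota 0 (2 ^ n)].
Proof.
rewrite -[LHS](mapK str_codeK) strs_code -[in LHS](addn0 (2 ^ n).-1) iotaDl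
  -map_comp.
exact: eq_map.
Qed.

Section strings.
Context A (eA : encodable A).
Implicit Types f g : A -> seq bool.

Lemma cf_strn (n : A -> nat) : cfun n -> cfun (fun x => strn (n x)).
Proof. by apply: (cf_code1 computable1_id) => a; exact: strnK. Qed.

Lemma cf_str_code f : cfun f -> cfun (fun x => str_code (f x)).
Proof. exact: (cf_code1 computable1_id). Qed.

Lemma cf_parent f : cfun f -> cfun (fun x => parent (f x)).
Proof.
have h : cfun (fun n : nat => n.-1./2) by computability.
move=> cf; apply: (@eq_cfun _ _ _ _ (fun x => strn (str_code (f x)).-1./2)).
  by move=> x; rewrite -str_code_parent str_codeK.
apply: cf_strn; apply: (cf_comp h); exact: cf_str_code.
Qed.

Lemma cf_rcons f (b : A -> bool) : cfun f -> cfun b -> cfun (fun x => rcons (f x)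
  (b x)).
Proof.
move=> cf cb.
have cc := cf_str_code cf.
apply: (@eq_cfun _ _ _ _ (fun x => strn ((str_code (f x) + str_code (f x)) + b
  x).+1)).
  by move=> x; rewrite addnn -str_code_rcons str_codeK.
by apply: cf_strn; computability.
Qed.

Lemma cf_streq f g : cfun f -> cfun g -> cfun (fun x => f x == g x).
Proof.
move=> cf cg; apply: (@eq_cfun _ _ _ _ (fun x => str_code (f x) == str_code (g x))).
  by move=> x; rewrite (inj_eq str_code_inj).
by apply: cf_eqn; exact: cf_str_code.
Qed.

End strings.

Section strings2.
Context A (eA : encodable A).
Implicit Types f g : A -> seq bool.

Lemma cf_size f : cfun f -> cfun (fun x => size (f x)).
Proof.
move=> cf; apply: (cf_comp (g := size)) cf.
(* The length is the least number of passages to the parent that lead to the empty string. *)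
have [||m [cm mP]] := @cf_mu _ _ (fun s n => iter n parent s == [::]).
- apply: cf_streq; last exact: cf_cst.
  apply: (cf_iter (f := fun t => t.1) (g := fun _ => parent)); computability.
  by apply: cf_parent; computability.
- by move=> s; exists (size s); rewrite iter_parent subnn take0.
apply: eq_cfun cm => s; have [/eqP h1 h2] := mP s.
have := h2 (size s); rewrite iter_parent subnn take0 => /(_ isT) cylm.
by move: h1; rewrite iter_parent => /(congr1 size); rewrite size_take_min /=; lia.
Qed.

Lemma cf_take (n : A -> nat) f : cfun n -> cfun f -> cfun (fun x => take (n x) (f
  x)).
Proof.
move=> cn cf.
have cs := cf_size cf.
apply: (@eq_cfun _ _ _ _ (fun x => iter (size (f x) - n x) parent (f x))).
  move=> x; rewrite iter_parent.
  have [h|h] := leqP (size (f x)) (n x); last by congr take; lia.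
  by rewrite (take_oversize h) (eqP h) subn0 take_size.
apply: (cf_iter (g := fun _ => parent)) => //; last by computability.
by apply: cf_parent; computability.
Qed.

Lemma cf_last f : cfun f -> cfun (fun x => last false (f x)).
Proof.
move=> cf.
have c1 := cf_str_code cf; have c2 := cf_str_code (cf_parent cf).
(* A final 1 gives twice the code of the parent plus 2. The empty string has code 0 and fails this
   test, in agreement with the default [false]. *)
apply: (@eq_cfun _ _ _ _ (fun x => str_code (f x) == (str_code (parent (f x)) +
  str_code (parent (f x))).+2)).
  move=> x; elim/last_ind: (f x) => // s b _.
  by rewrite parent_rcons str_code_rcons last_rcons; case: b; lia.
by computability.
Qed.

End strings2.

Ltac computability_string :=
  match goal with
  | |- cfun (fun x => parent (@?f x)) => apply (@cf_parent _ _ f)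
  | |- cfun (fun x => rcons (@?f x) (@?g x)) => apply (@cf_rcons _ _ f g)
  | |- cfun (fun x => take (@?f x) (@?g x)) => apply (@cf_take _ _ f g)
  | |- cfun (fun x => last false (@?f x)) => apply (@cf_last _ _ f)
  | |- cfun size => exact: (cf_size (cf_id _))
  | |- cfun (fun x => size (@?f x)) => apply (@cf_size _ _ f)
  | |- cfun (fun x => strn (@?f x)) => apply (@cf_strn _ _ f)
  | |- cfun (fun x => eq_op (@?f x) (@?g x)) => apply (@cf_streq _ _ f g)
  end.
Ltac computability_step ::= first [assumption | computability_arith
  | computability_expn | computability_string].

Import Order.TTheory GRing.Theory Num.Theory.
Import numFieldNormedType.Exports.
Local Open Scope ring_scope.

(** * Computable families of rationals and reals *)

Section rational.
Context (R : realType).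

(** Rationals given by integer data, so that their order is decidable, in contrast to that of
    [creal]. *)
Definition crat A (eA : encodable A) (q : A -> R) := exists a b c : A -> nat,
  [/\ cfun a, cfun b, cfun c &
    forall i, q i = ((a i)%:R - (b i)%:R) / (c i).+1%:R].
Arguments crat {A eA} q.

Lemma natSr_neq0 n : n.+1%:R != 0 :> R. Proof. by rewrite pnatr_eq0. Qed.

Lemma natSr_gt0 n : 0 < n.+1%:R :> R. Proof. by rewrite ltr0n. Qed.

Section closure.
Context A (eA : encodable A).
Implicit Types q r : A -> R.

Lemma eq_crat q r : q =1 r -> crat q -> crat r.
Proof.
by move=> qr [a [b [c [ca cb cc qE]]]]; exists a, b, c; split=> // i; rewrite -qr.
Qed.

Lemma crat_comp B (eB : encodable B) (q : B -> R) (f : A -> B) :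
  crat q -> cfun f -> crat (fun x => q (f x)).
Proof.
move=> [a [b [c [ca cb cc qE]]]] cf.
by exists (a \o f), (b \o f), (c \o f); split=> //; apply: cf_comp.
Qed.

Lemma crat_nat (f : A -> nat) : cfun f -> crat (fun x => (f x)%:R).
Proof.
move=> cf; exists f, (fun=> 0%N), (fun=> 0%N); split=> //; [exact: cf_cst..|].
by move=> i; rewrite subr0 divr1.
Qed.

Lemma crat_opp q : crat q -> crat (fun x => - q x).
Proof.
move=> [a [b [c [ca cb cc qE]]]]; exists b, a, c; split=> // i.
by rewrite qE -mulNr opprB.
Qed.

Lemma crat_add q r : crat q -> crat r -> crat (fun x => q x + r x).
Proof.
move=> [a [b [c [ca cb cc qE]]]] [a' [b' [c' [ca' cb' cc' rE]]]].
exists (fun x => a x * (c' x).+1 + a' x * (c x).+1)%N.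
exists (fun x => b x * (c' x).+1 + b' x * (c x).+1)%N.
exists (fun x => ((c x).+1 * (c' x).+1).-1)%N; split; [computability..|].
move=> i; rewrite prednK ?muln_gt0 // qE rE !natrD !natrM.
move: (natSr_neq0 (c i)) (natSr_neq0 (c' i)).
by move: (_.+1%:R) (_.+1%:R) => u v h1 h2; field; rewrite h1 h2.
Qed.

Lemma crat_mul q r : crat q -> crat r -> crat (fun x => q x * r x).
Proof.
move=> [a [b [c [ca cb cc qE]]]] [a' [b' [c' [ca' cb' cc' rE]]]].
exists (fun x => a x * a' x + b x * b' x)%N.
exists (fun x => a x * b' x + b x * a' x)%N.
exists (fun x => ((c x).+1 * (c' x).+1).-1)%N; split; [computability..|].
move=> i; rewrite prednK ?muln_gt0 // qE rE !natrD !natrM.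
move: (natSr_neq0 (c i)) (natSr_neq0 (c' i)).
by move: (_.+1%:R) (_.+1%:R) => u v h1 h2; field; rewrite h1 h2.
Qed.

Lemma crat_sub q r : crat q -> crat r -> crat (fun x => q x - r x).
Proof. by move=> cq cr; apply: crat_add => //; exact: crat_opp. Qed.

Lemma crat_if (p : A -> bool) q r : cfun p -> crat q -> crat r ->
  crat (fun x => if p x then q x else r x).
Proof.
move=> cp [a [b [c [ca cb cc qE]]]] [a' [b' [c' [ca' cb' cc' rE]]]].
exists (fun x => if p x then a x else a' x), (fun x => if p x then b x else b' x),
  (fun x => if p x then c x else c' x).
by split=> [| | |i]; [computability..|case: (p i)].
Qed.

Lemma crat_ratio (f g : A -> nat) : cfun f -> cfun g -> (forall x, (0 < g x)%N) ->
  crat (fun x => (f x)%:R / (g x)%:R).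
Proof.
move=> cf cg g0; exists f, (fun=> 0%N), (fun x => (g x).-1); split;
  [computability..|].
by move=> i; rewrite prednK // subr0.
Qed.

Lemma crat_numden q : crat q -> exists f g : A -> nat, [/\ cfun f, cfun g &
  forall x, 0 < q x -> q x = (f x).+1%:R / (g x).+1%:R].
Proof.
move=> [a [b [c [ca cb cc qE]]]].
exists (fun x => (a x - b x).-1)%N, c; split=> [||x]; [computability..|].
rewrite qE pmulr_lgt0 ?invr_gt0 ?natSr_gt0 // subr_gt0 ltr_nat => ba.
by rewrite prednK ?subn_gt0// natrB // ltnW.
Qed.

Lemma crat_inv q : crat q -> (forall x, 0 < q x) -> crat (fun x => (q x)^-1).
Proof.
move=> /crat_numden[f [g [cf cg qE]]] q0.
apply: (@eq_crat (fun x => (g x).+1%:R / (f x).+1%:R)); first by move=> x;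
  rewrite qE // invf_div.
by apply: crat_ratio => //; computability.
Qed.

Lemma crat_gt0 q : crat q -> cfun (fun x => 0 < q x).
Proof.
move=> [a [b [c [ca cb cc qE]]]].
apply: (@eq_cfun _ _ _ _ (fun x => (b x < a x)%N)); last by computability.
by move=> x; rewrite qE pmulr_lgt0 ?invr_gt0 ?natSr_gt0 // subr_gt0 ltr_nat.
Qed.

Lemma crat_lt q r : crat q -> crat r -> cfun (fun x => q x < r x).
Proof.
move=> cq cr; apply: eq_cfun (crat_gt0 (crat_sub cr cq)) => x; exact: subr_gt0.
Qed.

Lemma crat_exp2 (f : A -> nat) : cfun f -> crat (fun x => 2 ^- f x).
Proof.
move=> cf; apply: (@eq_crat (fun x => 1%:R / (2 ^ f x)%:R)).
  by move=> x; rewrite div1r natrX.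
by apply: crat_ratio => [||x]; rewrite ?expn_gt0 //; computability.
Qed.

Lemma crat_cst_nat n : crat (fun _ : A => n%:R).
Proof. by apply: crat_nat; computability. Qed.

Lemma crat_0 : crat (fun _ : A => 0).
Proof. exact: (crat_cst_nat 0). Qed.

Lemma crat_1 : crat (fun _ : A => 1).
Proof. exact: (crat_cst_nat 1). Qed.

(** The recursion runs on the triples that represent the rationals; the hypothesis on [op] says that
    it acts computably on representations. *)
Lemma crat_fold (op : R -> R -> R) (q0 : R) (q : A * nat -> R) (n : A -> nat) :
  crat (fun _ : A => q0) ->
  (exists f g h : nat * nat * nat * (nat * nat * nat) -> nat,
    [/\ cfun f, cfun g, cfun h & forall a b c a' b' c' : nat,
      op ((a%:R - b%:R) / c.+1%:R) ((a'%:R - b'%:R) / c'.+1%:R) =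
      ((f (a, b, c, (a', b', c')))%:R - (g (a, b, c, (a', b', c')))%:R)
        / (h (a, b, c, (a', b', c'))).+1%:R]) ->
  crat q -> cfun n ->
  crat (fun x => nat_rect (fun=> R) q0 (fun i y => op y (q (x, i))) (n x)).
Proof.
move=> [a0 [b0 [c0 [ca0 cb0 cc0 q0E]]]] [f [g [h [cf cg ch opE]]]]
  [a [b [c [ca cb cc qE]]]] cn.
pose t x := nat_rect (fun=> nat * nat * nat)%type (a0 x, b0 x, c0 x)
  (fun i y => let z := (y, (a (x, i), b (x, i), c (x, i))) in (f z, g z,
    h z)) (n x).
have ct : cfun t.
  apply: (cf_rec (f := fun x => (a0 x, b0 x, c0 x)) (g := fun x i y =>
    (f (y, (a (x, i), b (x, i), c (x, i))), g (y, (a (x, i), b (x, i), c (x, i))),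
      h (y, (a (x, i), b (x, i), c (x, i)))))) => //; first by computability.
  have c1 : cfun (fun t : A * nat * (nat * nat * nat) =>
    (t.2, (a (t.1.1, t.1.2), b (t.1.1, t.1.2), c (t.1.1, t.1.2)))).
    apply: cf_pair; first by computability.
    apply: cf_pair; last by apply: (cf_comp cc); computability.
    by apply: cf_pair; [apply: (cf_comp ca)|apply: (cf_comp cb)]; computability.
  by apply: cf_pair; [apply: cf_pair|];
    [exact: (cf_comp cf c1)|exact: (cf_comp cg c1)|exact: (cf_comp ch c1)].
exists (fun x => (t x).1.1), (fun x => (t x).1.2), (fun x => (t x).2).
split; [by apply: cf_fst; apply: cf_fst|by apply: cf_snd;
  apply: cf_fst|exact: cf_snd|].
move=> x; rewrite /t; elim: (n x) => [|m]; first exact: q0E.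
set T := nat_rect (fun=> (nat * nat * nat)%type) _ _ => ih.
rewrite [T m.+1]/= -/T [LHS]/= ih qE.
by case: (T m) => [[u v] w] /=; rewrite opE.
Qed.

Lemma crat_sum (q : A * nat -> R) (n : A -> nat) : crat q -> cfun n ->
  crat (fun x => \sum_(i < n x) q (x, val i)).
Proof.
move=> cq cn; apply: eq_crat (crat_fold (op := +%R) crat_0 _ cq cn).
  by move=> x; elim: (n x) => /= [|m ->]; rewrite ?big_ord0 ?big_ord_recr.
exists (fun t => t.1.1.1 * t.2.2.+1 + t.2.1.1 * t.1.2.+1)%N.
exists (fun t => t.1.1.2 * t.2.2.+1 + t.2.1.2 * t.1.2.+1)%N.
exists (fun t => (t.1.2.+1 * t.2.2.+1).-1)%N; split; [computability..|].
move=> a b c a' b' c'; cbv beta iota delta [fst snd];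
  rewrite prednK ?muln_gt0 // !natrD !natrM.
move: (natSr_neq0 c) (natSr_neq0 c').
by move: (_.+1%:R) (_.+1%:R) => u v h1 h2; field; rewrite h1 h2.
Qed.

Lemma crat_prod (q : A * nat -> R) (n : A -> nat) : crat q -> cfun n ->
  crat (fun x => \prod_(i < n x) q (x, val i)).
Proof.
move=> cq cn; apply: eq_crat (crat_fold (op := *%R) crat_1 _ cq cn).
  by move=> x; elim: (n x) => /= [|m ->]; rewrite ?big_ord0 ?big_ord_recr.
exists (fun t => t.1.1.1 * t.2.1.1 + t.1.1.2 * t.2.1.2)%N.
exists (fun t => t.1.1.1 * t.2.1.2 + t.1.1.2 * t.2.1.1)%N.
exists (fun t => (t.1.2.+1 * t.2.2.+1).-1)%N; split; [computability..|].
move=> a b c a' b' c'; cbv beta iota delta [fst snd];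
  rewrite prednK ?muln_gt0 // !natrD !natrM.
move: (natSr_neq0 c) (natSr_neq0 c').
by move: (_.+1%:R) (_.+1%:R) => u v h1 h2; field; rewrite h1 h2.
Qed.

End closure.
End rational.
Arguments crat {R A eA} q.

Section exp2.
Context (R : realType).
Lemma exp2N_gt0 n : 0 < 2 ^- n :> R.
Proof. by rewrite invr_gt0 exprn_gt0. Qed.

Lemma exp2N_ge0 n : 0 <= 2 ^- n :> R.
Proof. exact: ltW (exp2N_gt0 n). Qed.

Lemma exp2ND m n : 2 ^- (m + n) = 2 ^- m * 2 ^- n :> R.
Proof. by rewrite exprD invfM. Qed.

Lemma exp2NS n : 2 ^- n.+1 = 2 ^- n / 2 :> R.
Proof. by rewrite exprS invfM mulrC. Qed.

Lemma exp2N_le m n : (m <= n)%N -> 2 ^- n <= 2 ^- m :> R.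
Proof. by move=> mn; rewrite lef_pV2 ?posrE ?exprn_gt0 // ler_weXn2l // ler1n. Qed.

Lemma nat_le_exp2 n : n%:R <= 2 ^+ n :> R.
Proof. by rewrite -natrX ler_nat ltnW // ltn_expl. Qed.

Lemma nat_mul_exp2N n : n%:R * 2 ^- n <= 1 :> R.
Proof. by rewrite ler_pdivrMr ?exprn_gt0 // mul1r nat_le_exp2. Qed.

Lemma exp2N_small (e : R) : 0 < e -> exists n, 2 ^- n < e.
Proof.
move=> e0; exists (Num.truncn e^-1).+1.
rewrite invf_plt ?posrE ?exprn_gt0 //.
exact: lt_le_trans (truncnS_gt _) (nat_le_exp2 _).
Qed.
End exp2.

(** * Uniformly computable reals *)

Section real.
Context (R : realType).

Definition creal A (eA : encodable A) (x : A -> R) := exists q : A * nat -> R,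
  crat q /\ forall i n, `|x i - q (i, n)| <= 2 ^- n.
Arguments creal {A eA} x.

Section closure.
Context A (eA : encodable A).
Implicit Types x y : A -> R.

Lemma eq_creal x y : x =1 y -> creal x -> creal y.
Proof. by move=> xy [q [cq xq]]; exists q; split=> // i n; rewrite -xy. Qed.

Lemma creal_comp B (eB : encodable B) (x : B -> R) (f : A -> B) :
  creal x -> cfun f -> creal (fun i => x (f i)).
Proof.
move=> [q [cq xq]] cf; exists (fun t => q (f t.1, t.2)); split=> [|i n];
  last exact: xq.
by apply: (crat_comp cq); apply: cf_pair; [apply: (cf_comp cf)|]; computability.
Qed.

Lemma computable_reals_creal x : computable_reals enc x -> creal x.
Proof.
move=> [a [b [c [ca cb cc xE]]]].
exists (fun t => ((a (enc t.1) t.2)%:R - (b (enc t.1) t.2)%:R) / (c (enc t.1)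
  t.2).+1%:R).
split; last by move=> i n; exact: xE.
exists (fun t => a (enc t.1) t.2), (fun t => b (enc t.1) t.2),
  (fun t => c (enc t.1) t.2).
have h (f : nat -> nat -> nat) : computable2 f -> cfun (fun t : A * nat => f (enc
  t.1) t.2).
  move=> cf; apply: (cf_code2 (f := fun t : A * nat => t.1) (g := fun t => t.2)
    cf) => //; computability.
by split=> //; exact: h.
Qed.

(** Here every number has to be a code: [computable2] asks for programs that halt everywhere, [cfun]
    constrains them on codes only. *)
Lemma creal_computable_reals x (d : nat -> A) : cancel d enc -> cancel enc d ->
  creal x ->
  computable_reals enc x.
Proof.
move=> dK encK [q [[a [b [c [ca cb cc qE]]]] xq]].
have h (f : A * nat -> nat) : cfun f -> computable2 (fun u n => f (d u, n)).
  move=> [p pf]; have [r rE] := computable2_cpair; exists (Comp p (fun=> r)) => u n.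
  by apply: (eval_comp1 _ (pf (d u, n)));
    rewrite -[enc (d u, n)]/(cpair (enc (d u)) n) dK; exact: rE.
exists (fun u n => a (d u, n)), (fun u n => b (d u, n)), (fun u n => c (d u, n)).
by split; [exact: h..|move=> i n]; rewrite encK -qE.
Qed.

Lemma crat_creal x : crat x -> creal x.
Proof.
move=> cx; exists (fun t => x t.1); split; last by move=> i n;
  rewrite subrr normr0 exp2N_ge0.
by apply: (crat_comp cx); computability.
Qed.

(** Reading the approximation at precision [n + C] absorbs the factor, since [C 2^-C <= 1]. *)
Lemma creal_limQ x (C : A -> nat) (q : A * nat -> R) : cfun C -> crat q ->
  (forall i n, `|x i - q (i, n)| <= (C i)%:R * 2 ^- n) -> creal x.
Proof.
move=> cC cq xq; exists (fun t => q (t.1, t.2 + C t.1)%N); split.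
  apply: (crat_comp cq); computability; apply: (cf_comp cC); computability.
move=> i n; apply: le_trans (xq _ _) _.
rewrite /= addnC exp2ND mulrA ler_piMl ?exp2N_ge0 //; exact: nat_mul_exp2N.
Qed.

Lemma creal_lim x (C : A -> nat) (y : A * nat -> R) : cfun C -> creal y ->
  (forall i n, `|x i - y (i, n)| <= (C i)%:R * 2 ^- n) -> creal x.
Proof.
move=> cC [q [cq yq]] xy.
apply: (@creal_limQ x (fun i => (C i).+1) (fun t => q (t, t.2))).
- by computability.
- by apply: (crat_comp cq); computability.
- move=> i n; rewrite -natr1 mulrDl mul1r.
  rewrite (_ : x i - _ = (x i - y (i, n)) + (y (i, n) - q (i, n, n)));
    last by rewrite addrA subrK.
  by apply: le_trans (ler_normD _ _) _; apply: lerD;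
    [exact: xy|exact: (yq (i, n) n)].
Qed.

Lemma creal_add x y : creal x -> creal y -> creal (fun i => x i + y i).
Proof.
move=> [q [cq xq]] [r [cr yr]].
apply: (@creal_limQ _ (fun=> 2%N) (fun t => q t + r t));
  [computability|exact: crat_add|].
move=> i n; rewrite mulr_natl mulr2n opprD addrACA.
by apply: le_trans (ler_normD _ _) _; apply: lerD.
Qed.

Lemma creal_opp x : creal x -> creal (fun i => - x i).
Proof.
move=> [q [cq xq]]; exists (fun t => - q t); split; first exact: crat_opp.
by move=> i n; rewrite -opprD normrN.
Qed.

Lemma creal_sub x y : creal x -> creal y -> creal (fun i => x i - y i).
Proof. by move=> cx cy; apply: creal_add => //; exact: creal_opp. Qed.

Lemma creal_bound x : creal x -> exists B : A -> nat, cfun B /\ forall i,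
  `|x i| <= (B i)%:R.
Proof.
move=> [q [[a [b [c [ca cb cc qE]]]] xq]].
exists (fun i => a (i, 0%N) + b (i, 0%N) + 1)%N; split.
  by apply: cf_add; [apply: cf_add; [apply: (cf_comp ca)|apply: (cf_comp cb)]|];
    computability.
move=> i; rewrite -(subrK (q (i, 0%N)) (x i)) addrC.
apply: le_trans (ler_normD _ _) _; rewrite natrD; apply: lerD; last first.
  by have := xq i 0%N; rewrite expr0 invr1.
rewrite qE normrM [`|_^-1|]ger0_norm ?invr_ge0 ?ler0n //.
apply: le_trans (_ : `|(a (i, 0%N))%:R - (b (i, 0%N))%:R| <= _).
  by rewrite ler_piMr // invf_le1 ?ltr0n // ler1n.
by apply: le_trans (ler_normB _ _) _; rewrite !normr_nat -natrD.
Qed.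

Lemma creal_mul x y : creal x -> creal y -> creal (fun i => x i * y i).
Proof.
move=> cx cy; have [B [cB xB]] := creal_bound cx;
  have [B' [cB' yB']] := creal_bound cy.
case: cx cy => [q [cq xq]] [r [cr yr]].
(* The error is at most [|x| |y - r| + |x - q| |r|], where [|x| <= B] and [|r| <= B' + 1]. *)
apply: (@creal_limQ _ (fun i => B i + B' i + 1)%N (fun t => q t * r t));
  [computability|exact: crat_mul|].
move=> i n.
rewrite (_ : x i * y i - _ = x i * (y i - r (i, n)) + (x i - q (i, n)) * r (i,
  n)); last by ring.
have rB : `|r (i, n)| <= (B' i)%:R + 1.
  rewrite -[r _](addrNK (y i)) addrC; apply: le_trans (ler_normD _ _) _.
  apply: lerD => //; rewrite distrC; apply: le_trans (yr _ _) _.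
  by have := exp2N_le R (leq0n n); rewrite expr0 invr1.
apply: le_trans (ler_normD _ _) _; rewrite !normrM !natrD -addrA mulrDl.
apply: lerD; first by apply: ler_pM.
by rewrite mulrC; apply: ler_pM.
Qed.

Lemma creal_if (p : A -> bool) x y : cfun p -> creal x -> creal y ->
  creal (fun i => if p i then x i else y i).
Proof.
move=> cp [q [cq xq]] [r [cr yr]].
exists (fun t => if p t.1 then q t else r t); split; last by move=> i n /=;
  case: ifP.
by apply: crat_if => //; apply: (cf_comp cp); computability.
Qed.

Lemma creal_nat (f : A -> nat) : cfun f -> creal (fun i => (f i)%:R).
Proof. by move=> cf; apply: crat_creal; exact: crat_nat. Qed.

Lemma creal_exp2 (f : A -> nat) : cfun f -> creal (fun i => 2 ^- f i).
Proof. by move=> cf; apply: crat_creal; exact: crat_exp2. Qed.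

Lemma creal_sum (x : A * nat -> R) (n : A -> nat) : creal x -> cfun n ->
  creal (fun i => \sum_(j < n i) x (i, val j)).
Proof.
move=> [q [cq xq]] cn.
apply: (@creal_limQ _ n (fun t => \sum_(j < n t.1) q ((t.1, val j), t.2))) => //.
  apply: (@crat_sum _ _ _ (fun t : A * nat * nat => q ((t.1.1, t.2), t.1.2))).
    by apply: (crat_comp cq); computability.
  by apply: (cf_comp cn); computability.
move=> i m; rewrite -sumrB; apply: le_trans (ler_norm_sum _ _ _) _.
rewrite mulr_natl -[X in _ <= _ *+ X](card_ord (n i)) -sumr_const.
by apply: ler_sum => j _ /=.
Qed.

Lemma prod_dist (n : nat) (a b : 'I_n -> R) (e : R) :
  (forall j, 0 <= a j <= 1) -> (forall j, 0 <= b j <= 1) ->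
  (forall j, `|a j - b j| <= e) ->
  `|\prod_(j < n) a j - \prod_(j < n) b j| <= n%:R * e.
Proof.
elim: n a b => [|n ih] a b a01 b01 ab.
  by rewrite !big_ord0 subrr normr0 mul0r.
rewrite !big_ord_recl.
set p := \prod_(i < n) a _; set q := \prod_(i < n) b _.
rewrite (_ : _ - _ = (a ord0 - b ord0) * p + b ord0 * (p - q)); last by ring.
apply: le_trans (ler_normD _ _) _; rewrite !normrM -natr1 mulrDl mul1r addrC.
have p1 : `|p| <= 1.
  rewrite /p normr_prod; apply: prodr_ile1 => j _.
  by have /andP[h0 h1] := a01 (lift ord0 j); rewrite normr_ge0 ger0_norm.
apply: lerD.
  rewrite -[leRHS]mul1r; apply: ler_pM => //; last exact: ih.
  by have /andP[h0 h1] := b01 ord0; rewrite ger0_norm.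
by rewrite -[leRHS]mulr1; apply: ler_pM.
Qed.

Lemma creal_prod (x : A * nat -> R) (n : A -> nat) : (forall t, 0 <= x t <= 1) ->
  creal x -> cfun n -> creal (fun i => \prod_(j < n i) x (i, val j)).
Proof.
move=> x01 [q [cq xq]] cn.
(* Clamping to [[0, 1]], where [x] lies, does not increase the error and makes [prod_dist]
   applicable. *)
pose r t := if q t < 0 then 0 else if 1 < q t then 1 else q t.
have cr : crat r.
  apply: crat_if; [by apply: crat_lt => //; exact: crat_0|exact: crat_0|].
  by apply: crat_if => //; [by apply: crat_lt => //; exact: crat_1|exact: crat_1].
have r01 t : 0 <= r t <= 1.
  rewrite /r; case: (ltP (q t) 0) => h1; first by rewrite lexx ler01.
  by case: (ltP 1 (q t)) => h2; rewrite ?ler01 ?lexx // h1 h2.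
have xr t n' : `|x t - r (t, n')| <= 2 ^- n'.
  apply: le_trans (xq t n'); rewrite /r; have /andP[h1 h2] := x01 t.
  have n1 := ler_norm (x t - q (t, n')).
  have n2 := ler_norm (- (x t - q (t, n'))); rewrite normrN in n2.
  case: (ltP (q (t, n')) 0) => h3; last case: (ltP 1 (q (t, n'))) => h4 //.
    by rewrite subr0 ger0_norm //; lra.
  by rewrite ler0_norm; lra.
apply: (@creal_limQ _ n (fun t => \prod_(j < n t.1) r ((t.1, val j), t.2))) => //.
  apply: (@crat_prod _ _ _ (fun t : A * nat * nat => r ((t.1.1, t.2), t.1.2))).
    by apply: (crat_comp cr); computability.
  by apply: (cf_comp cn); computability.
by move=> i m; apply: prod_dist => j //; exact: r01.
Qed.

(** The substitute for deciding the order: an approximation with error [2^-n] is compared with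
    [2 * 2^-n], so the answer is reliable except in the overlap of the two cases. *)
Lemma creal_cmp x : creal x -> exists b : A * nat -> bool, cfun b /\ forall i n,
  if b (i, n) then 2 ^- n < x i else x i <= 2 ^- n * 4.
Proof.
move=> [q [cq xq]]; exists (fun t => 2 ^- t.2 * 2%:R < q t); split.
  apply: crat_lt => //; apply: crat_mul; last exact: crat_cst_nat.
  by apply: crat_exp2; computability.
move=> i n; have := xq i n; rewrite ler_norml => /andP[h1 h2] /=.
by case: (ltP (2 ^- n * 2%:R) (q (i, n))) => h3; lra.
Qed.

End closure.

Section closure2.
Context A (eA : encodable A).
Implicit Types x : A -> R.

(** The search stops at the first index that passes the test of [creal_cmp]. Existence is required
    with the larger margin, success is guaranteed with the smaller one, and the indices before
    failed the test, which bounds their values from above. *)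
Lemma creal_search (x : A * nat -> R) (k : A -> nat) : creal x -> cfun k ->
  (forall i, exists n, 2 ^- k i * 4 < x (i, n)) ->
  exists m : A -> nat, cfun m /\ forall i,
    2 ^- k i < x (i, m i) /\ forall j, (j < m i)%N -> x (i, j) <= 2 ^- k i * 4.
Proof.
move=> /creal_cmp[b [cb bP]] ck ex.
have [||m [cm mP]] := @cf_mu A _ (fun i n => b ((i, n), k i)).
- by apply: (cf_comp cb); computability; apply: (cf_comp ck); computability.
- move=> i; have [n nP] := ex i; exists n; apply: contraTT nP => /negbTE bn.
  by have := bP (i, n) (k i); rewrite bn -leNgt.
exists m; split=> // i; have [h1 h2] := mP i; split.
  by have := bP (i, m i) (k i); rewrite h1.
move=> j jm; have := bP (i, j) (k i); case: ifP => // bj.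
by have := h2 _ bj; rewrite leqNgt jm.
Qed.

Lemma creal_pos x : creal x -> (forall i, 0 < x i) ->
  exists k : A -> nat, cfun k /\ forall i, 2 ^- k i < x i.
Proof.
move=> /creal_cmp[b [cb bP]] x0.
have [||m [cm mP]] := @cf_mu A _ (fun i n => b (i, n)).
- by apply: (cf_comp cb); computability.
- move=> i; have [n nP] : exists n, 2 ^- n < x i / 4 by apply: exp2N_small;
  rewrite divr_gt0.
  exists n; have := bP i n; case: ifP => // _; lra.
exists m; split=> // i; have [h _] := mP i.
by have := bP i (m i); rewrite h.
Qed.

(** The inverse and the logarithm need approximations away from 0. Raising them to [2^-k], a lower
    bound of [x], does not increase the error. *)
Lemma creal_pos_approx x : creal x -> (forall i, 0 < x i) ->
  exists (k : A -> nat) (r : A * nat -> R), [/\ cfun k, crat r,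
    (forall i, 2 ^- k i <= x i), (forall i n, 2 ^- k i <= r (i, n)) &
    (forall i n, `|x i - r (i, n)| <= 2 ^- n)].
Proof.
move=> cx x0; have [k [ck kx]] := creal_pos cx x0; case: cx => q [cq xq].
have cfk : crat (fun t : A * nat => 2 ^- k t.1 : R).
  by apply: crat_exp2; apply: (cf_comp ck); computability.
exists k, (fun t => if q t < 2 ^- k t.1 then 2 ^- k t.1 else q t); split=> //.
- by apply: crat_if => //; exact: crat_lt.
- by move=> i; exact: ltW.
- by move=> i n /=; case: (ltP (q (i, n)) (2 ^- k i)).
- move=> i n /=; case: (ltP (q (i, n)) (2 ^- k i)) => // h;
  apply: le_trans (xq i n).
  have := kx i => ?; rewrite ger0_norm; last by lra.
  by have := ler_norm (x i - q (i, n)); lra.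
Qed.

Lemma creal_inv x : creal x -> (forall i, 0 < x i) -> creal (fun i => (x i)^-1).
Proof.
move=> cx x0; have [k [r [ck cr kx kr xr]]] := creal_pos_approx cx x0.
(* The error is [|x - r| / (x r)], and both factors of the denominator are at least [2^-k]. *)
apply: (@creal_limQ _ _ _ (fun i => 2 ^ (k i + k i))%N (fun t => (r t)^-1)).
- by computability.
- by apply: crat_inv => // -[i n]; apply: lt_le_trans (kr i n); exact: exp2N_gt0.
move=> i n; have r0 : 0 < r (i, n) by apply: lt_le_trans (kr i n); exact: exp2N_gt0.
have -> : (x i)^-1 - (r (i, n))^-1 = (r (i, n) - x i) * ((x i)^-1 * (r (i, n))^-1).
  by have := x0 i => ?; field; rewrite !gt_eqF.
rewrite normrM distrC mulrC; apply: ler_pM => //.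
have x0' := ltW (x0 i); have r0' := ltW r0.
rewrite ger0_norm ?mulr_ge0 ?invr_ge0 // natrX exprD.
apply: ler_pM; rewrite ?invr_ge0 //.
- by rewrite -[leRHS]invrK lef_pV2 ?posrE ?exp2N_gt0 ?kx.
- by rewrite -[leRHS]invrK lef_pV2 ?posrE ?exp2N_gt0 ?kr.
Qed.

(** For [a <= b] this is [ln (b / a) <= b / a - 1 = (b - a) / a]. *)
Lemma ln_lip (a b c : R) : 0 < c -> c <= a -> c <= b -> `|ln a - ln b| <= `|a -
  b| / c.
Proof.
move=> c0; wlog ab : a b / a <= b.
  move=> h ca cb; have [/h|/ltW/h] := leP a b; first by apply.
  by rewrite distrC [`|a - b|]distrC; apply.
move=> ca cb; have a0 := lt_le_trans c0 ca; have b0 := lt_le_trans c0 cb.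
rewrite distrC [`|a - b|]distrC !ger0_norm ?subr_ge0 ?ler_ln ?posrE //.
rewrite -ln_div ?posrE // -[b / a](subrK 1); apply: le_trans (_ : b / a - 1 <= _).
  rewrite [b / a - 1 + 1]addrC; apply: le_ln1Dx; rewrite ltrBrDl subrr divr_gt0 //.
rewrite -[1](divff (lt0r_neq0 a0)) -mulrBl ler_wpM2l ?subr_ge0 //.
by rewrite lef_pV2.
Qed.

End closure2.

(** The sum is that of [1/k] for [N + 1 < k <= (n + 1)(N + 1)], and [ln (n + 1)] is the sum of
    [ln k - ln (k - 1)] over the same [k]. Each difference lies between [1/k] and [1/(k - 1)], so
    the total error telescopes. *)
Lemma ln_harmonic (n N : nat) :
  `|ln n.+1%:R - \sum_(i < (n * N.+1)%N) 1%:R / (N.+1 + i).+1%:R| <= N.+1%:R^-1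
    :> R.
Proof.
have lnS (k : nat) : k.+2%:R^-1 <= ln (k.+2%:R : R) - ln k.+1%:R <= k.+1%:R^-1.
  have : 0 < k.+1%:R :> R by [].
  rewrite -[k.+2%:R]natr1; move: (k.+1%:R : R) => a a0.
  have a1 : 0 < a + 1 by rewrite addr_gt0.
  rewrite -ln_div ?posrE //; apply/andP; split.
    have := @le_ln1Dx R (- (a + 1)^-1).
    have -> : 1 - (a + 1)^-1 = ((a + 1) / a)^-1 by field; rewrite !gt_eqF.
    rewrite lnV ?posrE ?divr_gt0 // lerN2; apply.
    by rewrite ltrN2 invf_lt1 // ltrDr.
  have := @le_ln1Dx R a^-1.
  have -> : 1 + a^-1 = (a + 1) / a by field; rewrite gt_eqF.
  by apply; rewrite (lt_trans (ltrN10 _)) // invr_gt0.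
have lin (s l0 l1 l2 x y z : R) : x <= l2 - l1 <= y ->
    s <= l1 - l0 <= s + (z - y) -> s + x <= l2 - l0 <= s + x + (z - x).
  by move=> /andP[? ?] /andP[? ?]; apply/andP; split; lra.
have key M : \sum_(i < M) (1%:R / (N.+1 + i).+1%:R : R) <= ln ((N.+1 + M)%:R : R)
  - ln N.+1%:R
   <= \sum_(i < M) 1%:R / (N.+1 + i).+1%:R + (N.+1%:R^-1 - (N.+1 + M)%:R^-1).
  elim: M => [|M ih]; first by rewrite big_ord0 addn0 !subrr addr0 lexx.
  rewrite big_ord_recr /= addnS div1r; have := lnS (N + M)%N; rewrite -addSn.
  by move=> h; exact: lin h ih.
have := key (n * N.+1)%N.
rewrite -mulSn natrM lnM ?posrE // addrK => /andP[h1 h2].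
rewrite ger0_norm ?subr_ge0 //.
rewrite lerBlDl; apply: le_trans h2 _.
by rewrite lerD2l gerBl invr_ge0 mulr_ge0.
Qed.

Lemma creal_ln_nat A (eA : encodable A) (f : A -> nat) : cfun f ->
  creal (fun i => ln (f i).+1%:R).
Proof.
move=> cf; apply: (creal_comp (x := fun n => ln n.+1%:R)) cf.
(* With this choice the error [1 / (N m + 1)] is [2^-m]. *)
pose N m := (2 ^ m).-1.
have NE m : (N m).+1 = (2 ^ m)%N by rewrite prednK // expn_gt0.
exists (fun t => \sum_(i < (t.1 * (N t.2).+1)%N) 1%:R / ((N t.2).+1 + val
  i).+1%:R); split.
  apply: (crat_sum (q := fun t : nat * nat * nat => 1%:R / ((N t.1.2).+1 +
    t.2).+1%:R)); last first.
    by rewrite /N; computability.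
  by apply: crat_ratio => //; rewrite /N; computability.
move=> n m; have := ln_harmonic n (N m).
by rewrite [X in _ <= X^-1](_ : _ = 2 ^+ m) // NE natrX.
Qed.

Lemma creal_ln A (eA : encodable A) (x : A -> R) : creal x -> (forall i, 0 < x i) ->
  creal (fun i => ln (x i)).
Proof.
move=> cx x0; have [k [r [ck cr kx kr xr]]] := creal_pos_approx cx x0.
apply: (@creal_lim _ _ _ (fun i => 2 ^ k i)%N (fun t => ln (r t)));
  first by computability.
  have [f [g [cf cg rE]]] := crat_numden cr.
  apply: (@eq_creal _ _ (fun t => ln (f t).+1%:R - ln (g t).+1%:R)).
    move=> [i n]; rewrite -ln_div ?posrE // -rE //.
    by apply: lt_le_trans (kr i n); exact: exp2N_gt0.
  by apply: creal_sub; exact: creal_ln_nat.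
move=> i n; apply: le_trans (ln_lip (exp2N_gt0 _ (k i)) (kx i) (kr i n)) _.
by rewrite invrK mulrC natrX ler_wpM2l // exprn_ge0.
Qed.

(** The error bound [b] comes without a rate, but it is computable and takes arbitrarily small
    values, so an index where it is below [2^-n] can be searched for. *)
Lemma creal_lim_search A (eA : encodable A) (x : A -> R) (y b : A * nat -> R) :
  creal y -> creal b -> (forall i n, `|x i - y (i, n)| <= b (i, n)) ->
  (forall i (e : R), 0 < e -> exists n, b (i, n) < e) -> creal x.
Proof.
move=> cy cb xy b0.
have [|||m [cm mP]] := @creal_search (A * nat)%type _
   (fun t => 2 ^- t.1.2 - b (t.1.1, t.2)) (fun t => t.2 + 3)%N.
- apply: creal_sub; first by apply: creal_exp2; computability.
  by apply: (creal_comp cb); computability.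
- by computability.
(* The search at precision [n + 3] needs the margin [4 * 2^-(n+3)], half of [2^-n]; the other half
   is left for [b]. *)
- move=> [i n]; have [|k kP] := b0 i (2 ^- n / 2);
  first by rewrite divr_gt0 ?exp2N_gt0.
  exists k => /=; rewrite exp2ND.
  have -> : 2 ^- 3 = 8%:R^-1 :> R by rewrite -natrX.
  have := exp2N_gt0 R n; lra.
apply: (@creal_lim _ _ _ (fun=> 1%N) (fun t => y (t.1, m t)));
  first by computability.
  by apply: (creal_comp cy); computability.
move=> i n; rewrite mul1r; apply: le_trans (xy _ _) _.
by have [/= h _] := mP (i, n); have := exp2N_gt0 R (n + 3); lra.
Qed.

End real.
Arguments creal {R A eA} x.

(** * Relative entropy of masses on strings *)

Section mass.
Context (R : realType).
Implicit Types m u : seq bool -> R.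

(** Probability measures of full support, as functions on strings. *)
Definition mass m := [/\ m [::] = 1, (forall s, 0 < m s) &
  forall s, m s = m (rcons s false) + m (rcons s true)].

Definition mean m n (f : seq bool -> R) : R := \sum_(s <- strs n) m s * f s.

Lemma big_strsS (V : nmodType) n (f : seq bool -> V) :
  \sum_(s <- strs n.+1) f s = \sum_(s <- strs n) (f (rcons s false) + f (rcons s
    true)).
Proof.
rewrite /= big_flatten big_map; apply: eq_bigr => s _.
by rewrite big_cons big_seq1.
Qed.

Lemma eq_mean m n (f g : seq bool -> R) : (forall s,
  size s = n -> f s = g s) -> mean m n f = mean m n g.
Proof.
move=> fg; rewrite /mean big_seq [RHS]big_seq; apply: eq_bigr => s.
by rewrite mem_strs => /eqP/fg ->.
Qed.

Lemma meanD m n (f g : seq bool -> R) : mean m n (fun s => f s + g s) = mean m n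
  f + mean m n g.
Proof. by rewrite /mean -big_split /=; apply: eq_bigr => s _; rewrite mulrDr. Qed.

Lemma meanB m n (f g : seq bool -> R) : mean m n (fun s => f s - g s) = mean m n
  f - mean m n g.
Proof. by rewrite /mean -sumrB; apply: eq_bigr => s _; rewrite mulrBr. Qed.

Lemma meanZ m n c f : mean m n (fun s => c * f s) = c * mean m n f.
Proof. by rewrite /mean big_distrr /=; apply: eq_bigr => s _; rewrite mulrCA. Qed.

Lemma mean_sum m n k (f : 'I_k -> seq bool -> R) :
  mean m n (fun s => \sum_(i < k) f i s) = \sum_(i < k) mean m n (f i).
Proof.
rewrite /mean exchange_big /=; apply: eq_bigr => s _; exact: big_distrr.
Qed.

Section one_mass.
Context m (mm : mass m).

Lemma mass_nil : m [::] = 1. Proof. by case: mm. Qed.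
Lemma mass_gt0 s : 0 < m s. Proof. by case: mm. Qed.
Lemma mass_ge0 s : 0 <= m s. Proof. exact: ltW (mass_gt0 s). Qed.
Lemma mass_neq0 s : m s != 0. Proof. exact: lt0r_neq0 (mass_gt0 s). Qed.
Lemma massD s : m s = m (rcons s false) + m (rcons s true). Proof. by case: mm. Qed.

Lemma mean_S n f : mean m n.+1 (fun s => f (parent s)) = mean m n f.
Proof.
rewrite /mean big_strsS; apply: eq_bigr => s _.
by rewrite !parent_rcons -mulrDl -massD.
Qed.

Lemma mean_take n k f : mean m (n + k) (fun s => f (take n s)) = mean m n f.
Proof.
elim: k => [|k ih].
  by rewrite addn0; apply: eq_mean => s <-; rewrite take_size.
rewrite -ih addnS -[RHS]mean_S; apply: eq_mean => s sn.
by rewrite /parent take_takel // sn; lia.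
Qed.

Lemma mean_take_le n k f : (n <= k)%N -> mean m k (fun s => f (take n s)) = mean
  m n f.
Proof. by move=> /subnKC <-; exact: mean_take. Qed.

Lemma mean_cst n c : mean m n (fun=> c) = c.
Proof.
have := mean_take 0 n (fun=> c); rewrite add0n => ->.
by rewrite /mean /= big_seq1 mass_nil mul1r.
Qed.

Lemma le_mean n (f g : seq bool -> R) : (forall s,
  size s = n -> f s <= g s) -> mean m n f <= mean m n g.
Proof.
move=> fg; rewrite /mean big_seq [leRHS]big_seq; apply: ler_sum => s.
by rewrite mem_strs => /eqP/fg h; rewrite ler_wpM2l // mass_ge0.
Qed.

Lemma mean_ge0 n f : (forall s, size s = n -> 0 <= f s) -> 0 <= mean m n f.
Proof. by move=> f0; rewrite -(mean_cst n 0); exact: le_mean. Qed.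

Lemma mean_markov n (f : seq bool -> R) (t : R) : 0 < t -> (forall s,
  size s = n -> 0 <= f s) ->
  mean m n (fun s => (t <= f s)%R%:R) <= mean m n f / t.
Proof.
move=> t0 f0; rewrite ler_pdivlMr // mulrC -meanZ; apply: le_mean => s sn.
by case: (leP t (f s)) => h; rewrite ?mulr1 // mulr0 f0.
Qed.

End one_mass.

(** * One-bit divergences and the chain rule *)

Section two_masses.
Context m u (mm : mass m) (mu : mass u).

Definition step_KL_term (s : seq bool) (b : bool) :=
  m (rcons s b) / m s * ln ((m (rcons s b) / m s) / (u (rcons s b) / u s)).

Definition step_KL s := step_KL_term s false + step_KL_term s true.

(** The compensator of [ln (m / u)] in its Doob decomposition under [m]. *)
Definition path_KL s := \sum_(j < size s) step_KL (take j s).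

Lemma ln_ge_sub (x : R) : 0 < x -> 1 - x^-1 <= ln x.
Proof.
move=> x0; have := @le_ln1Dx R (x^-1 - 1).
rewrite (_ : 1 + (x^-1 - 1) = x^-1); last by rewrite addrC subrK.
rewrite lnV ?posrE // lerNl opprB; apply.
by rewrite ltrBrDl subrr invr_gt0.
Qed.

(** Gibbs' inequality for a single term, [p ln (p / q) >= p - q]; summed over the two bits, the
    lower bounds cancel. *)
Lemma step_KL_term_ge s b :
  m (rcons s b) / m s - u (rcons s b) / u s <= step_KL_term s b.
Proof.
rewrite /step_KL_term.
have : 0 < m (rcons s b) / m s by rewrite divr_gt0 ?mass_gt0.
have : 0 < u (rcons s b) / u s by rewrite divr_gt0 ?mass_gt0.
move: (m _ / m s) (u _ / u s) => p q q0 p0.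
have -> : p - q = p * (1 - (p / q)^-1) by field; rewrite !gt_eqF.
by rewrite ler_wpM2l ?(ltW p0) // ln_ge_sub // divr_gt0.
Qed.

Lemma step_KL_ge0 s : 0 <= step_KL s.
Proof.
have := lerD (step_KL_term_ge s false) (step_KL_term_ge s true).
have -> : m (rcons s false) / m s - u (rcons s false) / u s +
  (m (rcons s true) / m s - u (rcons s true) / u s) = 0; last by [].
have := mass_neq0 mm s; have := mass_neq0 mu s.
by rewrite [X in X != 0 -> _](massD mu) [X in _ -> X != 0 -> _](massD mm) (massD
  mm s) (massD mu s) => ? ?; field; apply/andP.
Qed.

Lemma path_KL_nil : path_KL [::] = 0.
Proof. by rewrite /path_KL big_ord0. Qed.

Lemma path_KL_rcons s b : path_KL (rcons s b) = path_KL s + step_KL s.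
Proof.
rewrite /path_KL size_rcons big_ord_recr /=; congr (_ + step_KL _).
  by apply: eq_bigr => j _; rewrite -cats1 takel_cat // ltnW.
by rewrite -cats1 take_size_cat.
Qed.

Lemma path_KL_ge0 s : 0 <= path_KL s.
Proof. by apply: sumr_ge0 => j _; exact: step_KL_ge0. Qed.

Lemma path_KL_take n s : path_KL (take n s) <= path_KL s.
Proof.
rewrite /path_KL size_take_min.
rewrite -(big_mkord predT (fun j => step_KL (take j (take n s)))).
rewrite -(big_mkord predT (fun j => step_KL (take j s))) /=.
rewrite (@big_cat_nat _ _ _ (minn n (size s)) 0 (size s)) ?geq_minr //=.
rewrite -[leLHS]addr0; apply: lerD; last by apply: sumr_ge0 => j _;
  exact: step_KL_ge0.
rewrite !big_nat; apply: ler_sum => j /andP[_ h].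
by rewrite take_takel //; move: h; rewrite leq_min => /andP[/ltnW].
Qed.

Definition KL_upto n := mean m n (fun s => ln (m s / u s)).

Lemma mean_path_KL_S n : mean m n.+1 path_KL = mean m n path_KL + mean m n step_KL.
Proof.
rewrite -meanD -[RHS](mean_S mm); apply: eq_mean => s; case/lastP: s => // s b _.
by rewrite parent_rcons path_KL_rcons.
Qed.

(** From [s] to a child, [m / u] is multiplied by the quotient of the transition probabilities, and
    the mean of the logarithm of this factor over the two children is [step_KL s]. *)
Lemma KL_uptoE n : KL_upto n = mean m n path_KL.
Proof.
elim: n => [|n ih].
  rewrite /KL_upto /mean /= !big_seq1 path_KL_nil !mass_nil // divr1 ln1.
  by [].
rewrite mean_path_KL_S -ih /KL_upto /mean big_strsS -big_split /=;
  apply: eq_bigr => s _.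
rewrite /step_KL /step_KL_term.
have h x y : x / m s / (y / u s) = (x / y) / (m s / u s).
  have := mass_neq0 mm s; have := mass_neq0 mu s; move=> ? ?.
  by rewrite !invfM !invrK; ring.
rewrite !h.
have lnq b : ln (m (rcons s b) / u (rcons s b) / (m s / u s)) =
  ln (m (rcons s b) / u (rcons s b)) - ln (m s / u s).
  by rewrite ln_div // posrE divr_gt0 ?mass_gt0.
rewrite !lnq; have := massD mm s; have := mass_neq0 mm s.
move: (ln (m s / u s)) (ln _) (ln _) => c a b.
move: (m s) (m _) (m _) => z x y z0 zE; rewrite zE in z0 *.
by field.
Qed.

Lemma KL_upto_mono n k : (n <= k)%N -> KL_upto n <= KL_upto k.
Proof.
move=> nk; rewrite !KL_uptoE -(mean_take_le mm path_KL nk).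
by apply: le_mean => // s _; exact: path_KL_take.
Qed.

End two_masses.
End mass.

Local Open Scope classical_set_scope.

(** * Measures on Cantor space *)

Lemma size_initseg w n : size (initseg w n) = n.
Proof. exact: size_mkseq. Qed.

Lemma initsegS w n : initseg w n.+1 = rcons (initseg w n) (w n).
Proof. exact: mkseqS. Qed.

Lemma take_initseg w n k : (n <= k)%N -> take n (initseg w k) = initseg w n.
Proof.
move=> nk; apply: (@eq_from_nth _ false);
  rewrite size_take_min !size_initseg (minn_idPl nk) //.
move=> i ik; rewrite nth_take // !nth_mkseq //; exact: leq_trans nk.
Qed.

Lemma parent_initseg w n : parent (initseg w n.+1) = initseg w n.
Proof. by rewrite initsegS parent_rcons. Qed.

Lemma cylE w s : cyl s w <-> initseg w (size s) = s.
Proof. by []. Qed.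

Lemma cyl_initseg w n : cyl (initseg w n) w.
Proof. by rewrite /cyl /= size_initseg. Qed.

Lemma cyl_preimage n s : size s = n -> (fun w => initseg w n) @^-1` [set s] = cyl s.
Proof. by move=> <-. Qed.

Lemma cyl_nil : cyl [::] = setT.
Proof. by apply/seteqP; split. Qed.

Lemma cyl_take s n w : cyl s w -> cyl (take n s) w.
Proof.
move=> /cylE <-; have [h|h] := leqP n (size s).
  by rewrite take_initseg //; exact: cyl_initseg.
by rewrite take_oversize ?size_initseg ?(ltnW h) //; exact: cyl_initseg.
Qed.

Lemma cyl_rcons s : cyl s = cyl (rcons s false) `|` cyl (rcons s true).
Proof.
apply/seteqP; split => w /=; rewrite /cyl /= !size_rcons initsegS.
  by move=> ->; case: (w (size s)); [right|left].
by case=> /eqP; rewrite eqseq_rcons => /andP[/eqP].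
Qed.

Lemma cyl_disjoint s t : size s = size t -> s != t -> cyl s `&` cyl t = set0.
Proof.
move=> st sNt; apply/seteqP; split => w //=; rewrite /cyl /= -st => -[-> h].
by rewrite h eqxx in sNt.
Qed.

Section measures.
Context (R : realType).
Implicit Types nu mu : probability cantor R.

Definition cylm nu s : R := fine (nu (cyl s)).

Lemma cylmE nu s : nu (cyl s) = (cylm nu s)%:E.
Proof. by rewrite /cylm fineK // fin_num_measure //; exact: measurable_cyl. Qed.

Lemma mass_cylm nu : full_support nu -> mass (cylm nu).
Proof.
move=> fs; split=> [|s|s].
- by rewrite /cylm cyl_nil probability_setT.
- by rewrite -lte_fin -cylmE.
- apply/EFin_inj; rewrite EFinD -!cylmE cyl_rcons measureU //;
  try exact: measurable_cyl.
  apply: cyl_disjoint; first by rewrite !size_rcons.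
  by rewrite eqseq_rcons eqxx.
Qed.

Lemma integral_finite_val d (T : measurableType d) (P : probability T R)
    (I : eqType) (h : T -> I) (r : seq I) (c : I -> R) :
  uniq r -> (forall w, h w \in r) -> (forall i,
    i \in r -> measurable (h @^-1` [set i])) ->
  (\int[P]_w (c (h w))%:E = (\sum_(i <- r) c i * fine (P (h @^-1` [set i])))%:E)%E.
Proof.
move=> ur hr mh.
(* The fibres are known to be measurable only for [i] in [r]; the guard makes every summand
   integrable without changing the sum. *)
transitivity (\int[P]_w (\sum_(i <- r) (if i \in r then (c i * \1_(h @^-1` [set
  i]) w)%:E else 0)))%E.
  apply: eq_integral => w _.
  rewrite (bigD1_seq _ (hr w) ur) /= hr indicE mem_set // mulr1 big1 ?adde0 // =>
    i ih.
  rewrite indicE memNset ?mulr0 ?if_same //= => hw.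
  by rewrite hw eqxx in ih.
rewrite integral_sum //; last first.
  move=> i; case: (boolP (i \in r)) => ir; last exact: integrable0.
  under eq_fun do rewrite EFinM.
  apply: integrableZl => //; apply: integrable_indic; exact: mh.
rewrite -sumEFin big_seq [RHS]big_seq; apply: eq_bigr => i ir; rewrite ir.
under eq_integral do rewrite EFinM.
rewrite integralZl //; last by apply: integrable_indic; exact: mh.
rewrite integral_indic ?setIT //; last exact: mh.
by rewrite EFinM fineK // fin_num_measure //; exact: mh.
Qed.

Lemma E_initseg nu n (f : seq bool -> R) :
  ('E_nu[fun w => f (initseg w n)] = (mean (cylm nu) n f)%:E)%E.
Proof.
rewrite unlock (@integral_finite_val _ _ nu _ (fun w => initseg w n) (strs n)).
- congr EFin; rewrite /mean big_seq [RHS]big_seq; apply: eq_bigr => s.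
  by rewrite mem_strs => /eqP sn; rewrite cyl_preimage // mulrC.
- exact: strs_uniq.
- by move=> w; rewrite mem_strs size_initseg.
- move=> s; rewrite mem_strs => /eqP sn; rewrite cyl_preimage //;
  exact: measurable_cyl.
Qed.

Lemma measurable_initseg n (p : pred (seq bool)) :
  measurable [set w : cantor | p (initseg w n)].
Proof.
have -> : [set w : cantor | p (initseg w n)] = \big[setU/set0]_(s <- strs n | p
  s) cyl s.
  apply/seteqP; split => w /=.
    move=> pw; rewrite -bigcup_seq_cond; exists (initseg w n) => /=.
      by rewrite mem_strs size_initseg eqxx.
    exact: cyl_initseg.
  rewrite -bigcup_seq_cond => -[s /= /andP[]]; rewrite mem_strs => /eqP <- ps.
  by rewrite /cyl /= => ->.
by apply: bigsetU_measurable => s _; exact: measurable_cyl.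
Qed.

Lemma measure_initseg nu n (p : pred (seq bool)) :
  nu [set w | p (initseg w n)] = (mean (cylm nu) n (fun s => (p s)%:R))%:E.
Proof.
rewrite -E_initseg -(expectation_indic nu (measurable_initseg n p)).
have -> // : \1_[set w : cantor | p (initseg w n)] =
  (fun w => (p (initseg w n))%:R) :> (cantor -> R).
apply: funext => w; rewrite indicE; case: (boolP (p _)) => h;
  first by rewrite mem_set.
by rewrite memNset //=; apply/negP.
Qed.

Lemma sup_KLE nu mu :
  sup_KL nu mu = ereal_sup (range (fun n => (KL_upto (cylm nu) (cylm mu) n)%:E)).
Proof.
rewrite /sup_KL; congr (ereal_sup _); apply: eq_imagel => n _.
exact: (E_initseg nu n (fun s => ln (cylm nu s / cylm mu s))).
Qed.

End measures.

(** * Divergence on the finite sigma-algebras *)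

Lemma Fspace_saturated n (A : set (Fspace n)) : measurable A ->
  forall w w' : cantor, initseg w n = initseg w' n -> A w -> A w'.
Proof.
move=> mA.
(* The sets that depend only on the first [n] bits form a sigma-algebra containing the cylinders of
   level [n]. *)
pose G := [set B : set cantor | forall w w',
  initseg w n = initseg w' n -> B w -> B w'].
have : <<s cyls n >> `<=` G; last by apply.
apply: smallest_sub.
  split=> [w w' //|B GB w w' ww' [_ nB]|F GF w w' ww' [i _ Fi]].
    by split=> // Bw'; apply: nB; apply: GB Bw'.
  by exists i => //; exact: GF Fi.
move=> _ [s /= sn <-] w w' ww'; rewrite /cyl /= sn => <-; exact: esym.
Qed.

Lemma measurable_cyl_Fspace n s : size s = n -> measurable (cyl s : set (Fspace n)).
Proof. by move=> sn; apply: sub_sigma_algebra; exists s. Qed.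

(** A representative of the cylinder of [s], namely [s] followed by zeros. *)
Definition word_point (s : seq bool) : cantor := nth false s.

Lemma initseg_word_point s : initseg (word_point s) (size s) = s.
Proof. exact: mkseq_nth. Qed.

Section KL.
Context (R : realType).
Local Open Scope ereal_scope.

(** By saturation the fibres of [h] are the atoms of the sigma-algebra, so the density is constant
    on each of them, equal to the quotient of the masses. On an atom that is null for [Q] the
    density is undetermined, but [P] vanishes there and so does the term. *)
Lemma KL_finite d (T : measurableType d) (P Q : probability T R) (I : choiceType)
    (h : T -> I) (r : seq I) (pt : I -> T) :
  uniq r -> (forall w, h w \in r) -> (forall i, i \in r -> h (pt i) = i) ->
  (forall i, i \in r -> measurable (h @^-1` [set i])) ->
  (forall A : set T, measurable A -> forall w w', h w = h w' -> A w -> A w') ->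
  (forall i, i \in r -> Q (h @^-1` [set i]) = 0 -> P (h @^-1` [set i]) = 0) ->
  KL P Q = (\sum_(i <- r) fine (P (h @^-1` [set i])) *
    ln (fine (P (h @^-1` [set i])) / fine (Q (h @^-1` [set i]))))%:E.
Proof.
move=> ur hr hpt mh hsat PQ0.
have PQ : charge_of_finite_measure P `<< Q.
  apply/null_content_dominatesP => A mA QA0; rewrite /charge_of_finite_measure.
  (* A measurable set is the union of the fibres whose representatives it contains. *)
  have AE : A = \big[setU/set0]_(i <- r | (i \in r) && `[< A (pt i) >]) (h @^-1`
    [set i]).
    apply/seteqP; split => w /=.
      move=> Aw; rewrite -bigcup_seq_cond; exists (h w) => //=.
      rewrite hr; apply/asboolP; apply: hsat Aw => //.
      by rewrite hpt.
    rewrite -bigcup_seq_cond => -[i /= /and3P[ir _ /asboolP Ai] hw].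
    by apply: hsat Ai => //; rewrite hpt.
  suff [] : measurable A /\ P A = 0 by [].
  rewrite AE; apply: (big_ind (fun B : set T => measurable B /\ P B = 0)).
  - by rewrite measure0.
  - move=> B C [mB B0] [mC C0]; split; first exact: measurableU.
    by rewrite measureU0.
  - move=> i /andP[ir /asboolP Ai]; split; first exact: mh.
    apply: PQ0 => //; apply/eqP; rewrite eq_le measure_ge0 andbT -QA0.
    apply: le_measure; rewrite ?inE //; first exact: mh.
    by move=> w hw; apply: hsat Ai => //; rewrite hpt.
rewrite /KL unlock.
set f := Radon_Nikodym _ _.
have mf : measurable_fun [set: T] f.
  by apply: (measurable_int Q); exact: Radon_Nikodym_integrable.
have f_cst w w' : h w = h w' -> f w' = f w.
  move=> ww'.
  have : measurable (f @^-1` [set f w]) by rewrite -[X in measurable X]setTI;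
    apply: mf.
  by move=> /hsat/(_ _ _ ww'); apply.
have f_fib i : i \in r -> P (h @^-1` [set i]) = f (pt i) * Q (h @^-1` [set i]).
  move=> ir; have mi := mh _ ir.
  transitivity (\int[Q]_(w in h @^-1` [set i]) f w).
    exact: (Radon_Nikodym_integral PQ).
  rewrite -integral_cst //; apply: eq_integral => w; rewrite inE => /= hw.
  by apply: f_cst; rewrite hpt.
transitivity (\int[P]_w (ln (fine (f (pt (h w)))))%:E).
  by apply: eq_integral => w _; congr (ln (fine _))%:E; apply: f_cst; rewrite hpt.
rewrite (@integral_finite_val _ _ _ P _ h r (fun i => ln (fine (f (pt i))))) //.
congr EFin; rewrite big_seq [RHS]big_seq; apply: eq_bigr => i ir; rewrite mulrC.
have [Q0|Q0] := eqVneq (Q (h @^-1` [set i])) 0;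
  first by rewrite (PQ0 _ ir Q0) /= !mul0r.
have mi := mh _ ir.
have Qfin : Q (h @^-1` [set i]) \is a fin_num by exact: fin_num_measure.
have ffin : f (pt i) \is a fin_num by exact: Radon_Nikodym_fin_num.
congr (_ * ln _)%R; rewrite (f_fib _ ir) fineM // mulfK //.
by rewrite fine_eq0.
Qed.

Lemma KL_Fspace n (P Q : probability (Fspace n) R) :
  (forall s, size s = n -> Q (cyl s) = 0 -> P (cyl s) = 0) ->
  KL P Q = (\sum_(s <- strs n)
    fine (P (cyl s)) * ln (fine (P (cyl s)) / fine (Q (cyl s))))%:E.
Proof.
move=> PQ0; rewrite (@KL_finite _ _ P Q _ (fun w => initseg w n) (strs n)
  word_point).
- congr EFin; rewrite big_seq [RHS]big_seq; apply: eq_bigr => s.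
  by rewrite mem_strs => /eqP sn; rewrite cyl_preimage.
- exact: strs_uniq.
- by move=> w; rewrite mem_strs size_initseg.
- by move=> s; rewrite mem_strs => /eqP <-; exact: initseg_word_point.
- by move=> s; rewrite mem_strs => /eqP sn; rewrite cyl_preimage //;
  exact: measurable_cyl_Fspace.
- exact: Fspace_saturated.
- by move=> s; rewrite mem_strs => /eqP sn; rewrite cyl_preimage //; exact: PQ0.
Qed.

Implicit Types nu mu : probability cantor R.

Lemma mnormalizeE d (T : measurableType d) (m : {measure set T -> \bar R})
    (P : probability T R) U :
  mnormalize m P U = if (m setT == 0) || (m setT == +oo) then P U
    else m U * ((fine (m setT))^-1)%:E.
Proof. by rewrite /mnormalize; case: ifP. Qed.

Lemma condp_cyl nu s t : full_support nu -> size t = (size s).+1 ->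
  restrF (size s).+1 (condp nu s) (cyl t) =
  (if parent t == s then cylm nu t / cylm nu s else 0)%:E.
Proof.
move=> fs ts.
rewrite /restrF /distribution /pushforward /=.
have -> : toF (size s).+1 @^-1` cyl t = cyl t by [].
have -> : condp nu s (cyl t) =
    if (nu (setT `&` cyl s) == 0) || (nu (setT `&` cyl s) == +oo) then nu (cyl t)
    else nu (cyl t `&` cyl s) * ((fine (nu (setT `&` cyl s)))^-1)%:E.
  exact: mnormalizeE.
have nus : 0 < nu (cyl s) := fs s.
(* Full support excludes the degenerate case of [mnormalize]. *)
rewrite setTI (gt_eqF nus) (cylmE nu s) /=.
case: eqP => [pts|pts].
  have -> : cyl t `&` cyl s = cyl t.
    apply/setIidPl => w wt; rewrite -pts /parent; exact: cyl_take.
  by rewrite cylmE EFinM.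
have -> : cyl t `&` cyl s = set0; last by rewrite measure0 mul0e.
apply/seteqP; split => w //= -[wt ws]; apply: pts.
have := cyl_take (size t).-1 wt; rewrite -/(parent t) /cyl /=.
have -> : size (parent t) = size s by rewrite /parent size_take_min ts /=; lia.
by move=> <-.
Qed.

(** Conditionally on [[s]], with [s] of length [n], only the two children of [s] carry mass at level
    [n + 1], and their terms make up [step_KL]. *)
Lemma condKLE n nu mu w : full_support nu -> full_support mu ->
  condKL n nu mu w = (step_KL (cylm nu) (cylm mu) (initseg w n))%:E.
Proof.
move=> fnu fmu; rewrite /condKL.
set s := initseg w n; have -> : n = size s by rewrite size_initseg.
rewrite KL_Fspace; last first.
  move=> t ts; rewrite !condp_cyl //; case: eqP => // _ [].
  by move/eqP; rewrite mulf_eq0 invr_eq0 !(negbTE (mass_neq0 (mass_cylm fmu) _)).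
congr EFin; rewrite big_strsS (bigD1_seq s) ?strs_uniq ?mem_strs //=.
rewrite big_seq_cond big1 ?addr0.
  rewrite !condp_cyl ?size_rcons // !parent_rcons eqxx //=.
move=> t /andP[]; rewrite mem_strs => /eqP ts tNs.
by rewrite !condp_cyl ?size_rcons ?ts // !parent_rcons (negbTE tNs) /= !mul0r addr0.
Qed.

End KL.

(** * Cylinders as a basis of the topology *)

Lemma cyl_initseg_sub w n k : (n <= k)%N -> cyl (initseg w k) `<=` cyl (initseg w
  n).
Proof. by move=> nk v /(@cyl_take _ n); rewrite take_initseg. Qed.

(** The filter of the cylinders around [w] converges to [w] in each coordinate, hence in the product
    topology. *)
Lemma open_cyl_basis (U : set cantor_space) (w : cantor_space) :
  open U -> U w -> exists n, cyl (initseg w n) `<=` U.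
Proof.
move=> oU Uw.
pose F := filter_from setT (fun n => cyl (initseg w n) : set cantor_space).
have FF : Filter F.
  apply: filter_from_filter; first by exists 0%N.
  move=> n k _ _; exists (maxn n k) => // v h.
  by split; apply: cyl_initseg_sub h; rewrite ?leq_maxl ?leq_maxr.
have Fw : F --> w.
  apply/(@cvg_sup _ _ _ F w) => i.
  apply/cvg_image.
    apply/seteqP; split => // b _; exists (fun=> b) => //.
  move=> B /nbhs_singleton Bwi.
  exists ((fun f : cantor_space => f i) @^-1` B); last first.
    apply/seteqP; split => [b [f /= Bf <-] //|b Bb].
    by exists (fun=> b).
  exists i.+1 => // v /cylE; rewrite size_initseg !initsegS => /eqP.
  by rewrite eqseq_rcons => /andP[_ /eqP]; rewrite /preimage /= => ->.
have [n _ nU] := Fw U (open_nbhs_nbhs (conj oU Uw)).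
by exists n.
Qed.

Lemma open_bigcup_cyl (U : set cantor_space) : open U ->
  U = \bigcup_(n in [set n | cyl (strn n) `<=` U]) cyl (strn n).
Proof.
move=> oU; apply/seteqP; split => w.
  move=> /(open_cyl_basis oU)[n nU]; exists (str_code (initseg w n)).
    by rewrite /= str_codeK.
  rewrite str_codeK; exact: cyl_initseg.
by move=> [n /= h]; exact: h.
Qed.

(** There are countably many cylinders, so every open set is a countable union of them. *)
Lemma measurable_to_cantor d (T : measurableType d) (f : T -> cantor) :
  (forall s, measurable (f @^-1` cyl s)) -> measurable_fun [set: T] f.
Proof.
move=> mf; apply: (@measurability _ _ T cantor setT f (@open cantor_space)) => //.
move=> _ [U oU <-]; rewrite setTI (open_bigcup_cyl oU) preimage_bigcup.
by apply: bigcup_measurable => n _; exact: mf.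
Qed.

(* The quantile map: [quantile x] is the sequence of choices made when [0,1) is
   recursively split into half-open intervals, the interval of [s] having
   length [m s]. *)
Section quantile.
Context (R : realType) (m : seq bool -> R).

(** The recursion is on the reversed string because intervals are split by extending a string at its
    end; a last bit 1 skips the interval of the sibling. *)
Fixpoint left_end_rev (s : seq bool) : R := if s is b :: t then
  left_end_rev t + (if b then m (rcons (rev t) false) else 0) else 0.

Definition left_end s := left_end_rev (rev s).

Lemma left_end_rcons s b :
  left_end (rcons s b) = left_end s + (if b then m (rcons s false) else 0).
Proof. by rewrite /left_end rev_rcons /= revK. Qed.

Definition split_test s x := left_end s + m (rcons s false) <= x.

Fixpoint quantile_path (x : R) n : seq bool := if n is k.+1 then
  rcons (quantile_path x k) (split_test (quantile_path x k) x) else [::].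

Definition quantile (x : measurableTypeR R) : cantor :=
  fun n => split_test (quantile_path x n) x.

Lemma initseg_quantile x n : initseg (quantile x) n = quantile_path x n.
Proof. by elim: n => //= n ih; rewrite initsegS ih. Qed.

Lemma quantile_cylP x s b :
  cyl (rcons s b) (quantile x) <-> cyl s (quantile x) /\ split_test s x = b.
Proof.
rewrite /cyl /= size_rcons !initseg_quantile /=; split.
  by move=> /eqP; rewrite eqseq_rcons => /andP[/eqP -> /eqP ->].
by move=> [-> ->].
Qed.

Lemma measurable_quantile : measurable_fun [set: measurableTypeR R] quantile.
Proof.
apply: measurable_to_cantor; elim/last_ind => [|s b ih].
  by rewrite cyl_nil preimage_setT.
have -> : quantile @^-1` cyl (rcons s b) = quantile @^-1` cyl s `&`
   (if b then `[left_end s + m (rcons s false), +oo[%classic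
    else `]-oo, left_end s + m (rcons s false)[%classic).
  apply/seteqP; split => x /=; rewrite quantile_cylP /split_test => -[h1 h2];
    split=> //.
    by case: b h2 => /= h2; rewrite in_itv /= ?andbT // ltNge h2.
  by case: b h2 => /=; rewrite in_itv /= ?andbT // ltNge => /negbTE.
by apply: measurableI => //; case: b; exact: measurable_itv.
Qed.

HB.instance Definition _ :=
  isMeasurableFun.Build _ _ _ _ quantile measurable_quantile.

Hypothesis mm : mass m.

Lemma quantile_cyl s x : 0 <= x < 1 ->
  cyl s (quantile x) <-> left_end s <= x < left_end s + m s.
Proof.
move=> x01; elim/last_ind: s => [|s b ih].
  by rewrite cyl_nil /left_end /= mass_nil // add0r x01.
rewrite quantile_cylP ih left_end_rcons /split_test (massD mm s).
have := mass_gt0 mm (rcons s false); have := mass_gt0 mm (rcons s true).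
case: b; move: (m (rcons s false)) (m (rcons s true)) (left_end s) => u v l v0 u0;
  rewrite ?addr0; split.
- by move=> [/andP[h1 h2]]; rewrite -/(is_true _) => h3; apply/andP; split; lra.
- by move=> /andP[h1 h2]; split; [apply/andP; split|rewrite -/(is_true _)]; lra.
- by move=> [/andP[h1 h2] /negbT]; rewrite -ltNge => h3; apply/andP; split; lra.
- move=> /andP[h1 h2]; split; first by apply/andP; split; lra.
  by apply/negbTE; rewrite -ltNge.
Qed.

Lemma left_end_ge0 s : 0 <= left_end s.
Proof.
elim/last_ind: s => [|s b ih]; first by [].
by rewrite left_end_rcons addr_ge0 //; case: b => //; exact: mass_ge0.
Qed.

Lemma right_end_le1 s : left_end s + m s <= 1.
Proof.
elim/last_ind: s => [|s b ih]; first by rewrite /left_end /= mass_nil // add0r.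
move: ih; rewrite left_end_rcons (massD mm s).
have := mass_ge0 mm (rcons s false); have := mass_ge0 mm (rcons s true).
by case: b; lra.
Qed.

End quantile.

(** The image of Lebesgue measure on [[0, 1)] under the quantile map: the preimage of a cylinder is
    an interval of length [m s]. *)
Lemma mass_probability (R : realType) (m : seq bool -> R) : mass m ->
  exists mu : probability cantor R, forall s, mu (cyl s) = (m s)%:E.
Proof.
move=> mm.
pose I01 : set (measurableTypeR R) := `[0%R, 1%R[%classic.
have mI : measurable I01 by exact: measurable_itv.
pose L : {measure set (measurableTypeR R) -> \bar R} := mrestr lebesgue_measure mI.
(* [L] already has total mass 1; normalizing gives it the type of a probability, with a Dirac mass
   as the formal default. *)
pose P : probability (measurableTypeR R) R := mnormalize L \d_(0 :
  measurableTypeR R).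
exists (distribution P (quantile m)) => s.
have LE U : L U = lebesgue_measure (U `&` I01) by [].
have LT : L setT = 1%E.
  by rewrite LE setTI lebesgue_measure_itv /= lte_fin ltr01 oppr0 adde0.
transitivity (mnormalize L \d_(0 : measurableTypeR R) (quantile m @^-1` cyl s)).
  by [].
rewrite mnormalizeE LT /= invr1 mule1 ifF; last first.
  by apply/negbTE; rewrite negb_or onee_neq0.
rewrite LE (_ : _ `&` _ = `[left_end m s, left_end m s + m s[%classic).
  rewrite lebesgue_measure_itv /= lte_fin ltrDl mass_gt0 //.
  by rewrite -EFinD addrC addKr.
apply/seteqP; split => x /=; rewrite !in_itv /=.
  by move=> [h /(quantile_cyl mm s) <-].
move=> h; have x01 : 0 <= x < 1.
  have := left_end_ge0 mm s; have := right_end_le1 mm s.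
  by case/andP: h => *; apply/andP; split; lra.
by split=> //; apply/(quantile_cyl mm s).
Qed.

(** * Boundedness at random points *)

Lemma cfun_computable2 (f : nat -> nat -> seq bool) :
  cfun (fun t : nat * nat => f t.1 t.2) <-> computable2 (fun n k => str_code (f n
    k)).
Proof.
split=> [[p pf]|fc].
  have [r rE] := computable2_cpair; exists (Comp p (fun=> r)) => n k.
  exact: (eval_comp1 (rE n k) (pf (n, k))).
by apply: (cf_code2 (f := fun t : nat * nat => t.1) (g := fun t => t.2) fc);
  computability.
Qed.

(** The enumeration has to be total, so a candidate [strn k] that fails the test is replaced by a
    string [strn (d n)] known to pass it. This is why every level must contain some string. *)
Lemma ce_opens_dec (P : nat -> seq bool -> bool) :
  cfun (fun t : nat * seq bool => P t.1 t.2) -> (forall n, exists s, P n s) ->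
  ce_opens (fun n => [set w | exists s, P n s /\ cyl s w]).
Proof.
move=> cP exP.
have [||d [cd dP]] := @cf_mu nat _ (fun n k => P n (strn k)).
- by apply: (cf_op2 (h := P) cP); computability.
- by move=> n; have [s Ps] := exP n; exists (str_code s); rewrite str_codeK.
exists (fun n k => if P n (strn k) then strn k else strn (d n)); split.
  apply/cfun_computable2; apply: cf_if.
  - by apply: (cf_op2 (h := P) cP); computability.
  - by computability.
  - by apply: cf_strn; apply: (cf_comp cd); computability.
move=> n; apply/seteqP; split => w /=.
  by move=> [s [Ps ws]]; exists (str_code s) => //; rewrite str_codeK Ps.
move=> [k _]; case: ifPn => [Pk wk|_ wd]; first by exists (strn k).
by exists (strn (d n)); split=> //; have [] := dP n.
Qed.

(** * Computability of the divergences *)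

Section computable_KL.
Context (R : realType).

Lemma creal_mean A (eA : encodable A) (m : seq bool -> R) (f : A * seq bool -> R)
    (n : A -> nat) : creal m -> creal f -> cfun n ->
  creal (fun a => mean m (n a) (fun s => f (a, s))).
Proof.
move=> cm cf cn.
apply: (@eq_creal _ _ _ (fun a => \sum_(i < (2 ^ n a)%N)
    (m (strn ((2 ^ n a).-1 + i)) * f (a, strn ((2 ^ n a).-1 + i))))).
  move=> a; rewrite /mean strsE big_map -(big_mkord predT (fun i =>
    m (strn ((2 ^ n a).-1 + i)) * f (a, strn ((2 ^ n a).-1 + i)))).
  by rewrite /index_iota subn0.
apply: (creal_sum (x := fun t : A * nat => m (strn ((2 ^ n t.1).-1 + t.2)) *
   f (t.1, strn ((2 ^ n t.1).-1 + t.2)))); last by computability.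
have c1 : cfun (fun t : A * nat => n t.1) by apply: (cf_comp cn); computability.
by apply: creal_mul; [apply: (creal_comp cm)|apply: (creal_comp cf)]; computability.
Qed.

Context (m u : seq bool -> R) (mm : mass m) (mu : mass u) (cm : creal m) (cu :
  creal u).

Lemma creal_cond b : creal (fun s => m (rcons s b) / m s).
Proof.
apply: creal_mul; last exact: creal_inv (mass_gt0 mm).
by apply: (creal_comp cm); computability.
Qed.

End computable_KL.

Section computable_KL2.
Context (R : realType).
Context (m u : seq bool -> R) (mm : mass m) (mu : mass u) (cm : creal m) (cu :
  creal u).

Lemma creal_step_KL : creal (step_KL m u).
Proof.
have h b : creal (fun s => step_KL_term m u s b).
  have c1 := creal_cond mm cm b; have c2 := creal_cond mu cu b.
  apply: creal_mul => //; apply: creal_ln; last first.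
    by move=> s; rewrite !divr_gt0 ?mass_gt0.
  apply: creal_mul => //; apply: creal_inv => // s; rewrite divr_gt0 ?mass_gt0 //.
by apply: creal_add; exact: h.
Qed.

Lemma creal_path_KL : creal (path_KL m u).
Proof.
apply: (creal_sum (x := fun t : seq bool * nat => step_KL m u (take t.2 t.1)));
  last by computability.
by apply: (creal_comp creal_step_KL); computability.
Qed.

Lemma creal_KL_upto : creal (KL_upto m u).
Proof.
apply: (creal_mean (f := fun t : nat * seq bool => ln (m t.2 / u t.2)) cm);
  last by computability.
have c1 : creal (fun t : nat * seq bool => m t.2) by apply: (creal_comp cm);
  computability.
have c2 : creal (fun t : nat * seq bool => u t.2) by apply: (creal_comp cu);
  computability.
apply: creal_ln; last by move=> t; rewrite divr_gt0 ?mass_gt0.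
by apply: creal_mul => //; apply: creal_inv => // t; rewrite mass_gt0.
Qed.

End computable_KL2.

Section measure_facts.
Context (R : realType).
Implicit Types nu mu : probability cantor R.

Lemma creal_cylm nu : computable_measure nu -> creal (cylm nu).
Proof. exact: computable_reals_creal. Qed.

Lemma le_sup_KL nu mu (r : R) : (sup_KL nu mu = r%:E) -> forall n,
  KL_upto (cylm nu) (cylm mu) n <= r.
Proof.
rewrite sup_KLE => supE n; rewrite -lee_fin -supE; apply: ereal_sup_ubound.
by exists n.
Qed.

Lemma sup_KL_adherent nu mu (r : R) : (sup_KL nu mu = r%:E) ->
  forall e, 0 < e -> exists n, r - e < KL_upto (cylm nu) (cylm mu) n.
Proof.
rewrite sup_KLE => supE e e0.
have := @ub_ereal_sup_adherent R (range (fun n => (KL_upto (cylm nu) (cylm mu)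
  n)%:E)) e e0.
rewrite supE => /(_ isT)[_ [n _ <-]]; rewrite -EFinB lte_fin => h.
by exists n.
Qed.

Lemma sup_KL_bounded nu mu (C : R) : (forall n,
  KL_upto (cylm nu) (cylm mu) n <= C) ->
  sup_KL nu mu \is a fin_num.
Proof.
move=> h; rewrite sup_KLE fin_numE; apply/andP; split.
  rewrite gt_eqF // (lt_le_trans (ltNyr (KL_upto (cylm nu) (cylm mu) 0))) //.
  by apply: ereal_sup_ubound; exists 0%N.
rewrite lt_eqF // (le_lt_trans _ (ltry C)) //.
by apply: ge_ereal_sup => _ [n _ <-]; rewrite lee_fin.
Qed.

Lemma sum_condKL nu mu w n : full_support nu -> full_support mu ->
  (\sum_(0 <= k < n) condKL k nu mu w = (path_KL (cylm nu) (cylm mu) (initseg w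
    n))%:E)%E.
Proof.
move=> fnu fmu; elim: n => [|n ih].
  by rewrite big_nil /= path_KL_nil.
by rewrite big_nat_recr //= ih condKLE // initsegS path_KL_rcons EFinD.
Qed.

Lemma condKL_summable nu mu w : full_support nu -> full_support mu ->
  (\sum_(0 <= n <oo) condKL n nu mu w < +oo)%E <->
  exists C : R, forall n, path_KL (cylm nu) (cylm mu) (initseg w n) <= C.
Proof.
move=> fnu fmu.
have ge0 n : (0 <= condKL n nu mu w)%E.
  by rewrite condKLE // lee_fin step_KL_ge0 //; exact: mass_cylm.
split=> [fin|[C hC]].
  exists (fine (\sum_(0 <= n <oo) condKL n nu mu w)%E) => n.
  rewrite -lee_fin fineK; last by rewrite ge0_fin_numE // nneseries_ge0.
  by rewrite -sum_condKL //; apply: nneseries_lim_ge.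
apply: le_lt_trans (ltry C); apply: lime_le.
  exact: is_cvg_nneseries.
by apply: nearW => n; rewrite sum_condKL // lee_fin.
Qed.

(** Markov's inequality holds at each level with the same constant, and the sets increase with the
    level because [path_KL] does. *)
Lemma measure_path_ge nu mu (C t : R) : full_support nu -> full_support mu ->
  (forall n, KL_upto (cylm nu) (cylm mu) n <= C) -> 0 < t ->
  (nu (\bigcup_n [set w | (t <= path_KL (cylm nu) (cylm mu) (initseg w n))%R]) <=
    (C / t)%:E)%E.
Proof.
move=> fnu fmu hC t0; have mm := mass_cylm fnu; have mmu := mass_cylm fmu.
pose p := fun s => t <= path_KL (cylm nu) (cylm mu) s.
have cv : nu [set w | p (initseg w n)] @[n --> \oo] --> nu (\bigcup_n [set w | p
  (initseg w n)]).
  apply: nondecreasing_cvg_mu.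
  - by move=> n; exact: measurable_initseg.
  - by apply: bigcup_measurable => n _; exact: measurable_initseg.
  - apply/nondecreasing_seqP => n; apply/subsetPset => w /= h; apply: le_trans h _.
    by rewrite initsegS path_KL_rcons lerDl step_KL_ge0.
rewrite -(cvg_lim _ cv) //; apply: lime_le; first by apply/cvg_ex; eexists;
  exact: cv.
apply: nearW => n; rewrite measure_initseg lee_fin.
apply: le_trans (mean_markov mm t0 _) _; first by move=> s _; exact: path_KL_ge0.
by rewrite -KL_uptoE // ler_wpM2r // invr_ge0 ltW.
Qed.

Lemma measure_bigcup_tail nu (V : nat -> set cantor) (N : nat) :
  (forall j, measurable (V j)) -> (forall j, (nu (V j) <= (2 ^- j)%:E)%E) ->
  (nu (\bigcup_(j in [set j | (N <= j)%N]) V j) <= (2 * 2 ^- N)%:E)%E.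
Proof.
move=> mV hV.
have -> : \bigcup_(j in [set j | (N <= j)%N]) V j = \bigcup_j V (N + j)%N.
  apply/seteqP; split => w [j /= h Vw].
    by exists (j - N)%N => //; rewrite subnKC.
  by exists (N + j)%N => //=; exact: leq_addr.
have sub : (nu (\bigcup_j V (N + j)%N) <= \sum_(n <oo) nu (V (N + n)%N))%E.
  by apply: measure_sigma_subadditive => //; exact: bigcupT_measurable.
apply: le_trans sub _.
apply: lime_le; first by apply: is_cvg_nneseries => n _ _; exact: measure_ge0.
apply: nearW => n /=.
apply: le_trans (_ : ((2 * 2 ^- N - 2 * 2 ^- (N + n)) %:E <= _)%E); last first.
  by rewrite lee_fin gerBl mulr_ge0 // exp2N_ge0.
elim: n => [|n ih]; first by rewrite big_nil addn0 subrr.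
rewrite big_nat_recr //=; apply: le_trans (leeD ih (hV _)) _.
by rewrite -EFinD lee_fin addnS exp2NS; have := exp2N_gt0 R (N + n)%N; lra.
Qed.

End measure_facts.

Section random_bounded.
Context (R : realType) (nu mu : probability cantor R).
Hypotheses (cnu : computable_measure nu) (fnu : full_support nu).
Hypotheses (cmu : computable_measure mu) (fmu : full_support mu).
Let mnu := mass_cylm fnu.
Let mmu := mass_cylm fmu.
Let path := path_KL (cylm nu) (cylm mu).

Lemma MLR_path_bounded w : ll_kl nu mu -> MLR nu w ->
  exists C : R, forall n, path (initseg w n) <= C.
Proof.
move=> kl wMLR; apply: contrapT => unb.
have {}unb (C : R) : exists n, C < path (initseg w n).
  apply: contrapT => h; apply: unb; exists C => n; rewrite leNgt; apply/negP => ?.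
  by apply: h; exists n.
have [r rE] : exists r : R, sup_KL nu mu = r%:E by exists (fine (sup_KL nu mu));
  rewrite fineK.
have rle := le_sup_KL rE.
(* With [2^c] above the supremum, Markov's inequality at [2^(n+c)] gives [2^-n]. *)
pose c := (Num.truncn r).+1.
have rc n : KL_upto (cylm nu) (cylm mu) n <= 2 ^+ c.
  apply: le_trans (rle n) _; apply: le_trans (ltW (truncnS_gt _)) (nat_le_exp2 _ _).
have cpath : creal path := creal_path_KL mnu mmu (creal_cylm cnu) (creal_cylm cmu).
(* At precision 0 a positive answer means an excess above 1, a negative one an excess of at most 4;
   unboundedness at [w] yields prefixes with excess above 4. *)
have [|b [cb bP]] := @creal_cmp R (nat * seq bool)%type _ (fun t => path t.2 - 2
  ^+ (t.1 + c)).
  apply: creal_sub; first by apply: (creal_comp cpath); computability.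
  apply: (@eq_creal _ _ _ (fun t : nat * seq bool => (2 ^ (t.1 + c))%:R)).
    by move=> t; rewrite natrX.
  by apply: creal_nat; computability.
pose P n s := b ((n, s), 0%N).
have PW n : exists k, P n (initseg w k).
  have [k hk] := unb (2 ^+ (n + c) + 4); exists k.
  have := bP (n, initseg w k) 0%N; rewrite /P; case: ifP => // _ /=.
  by rewrite expr0 invr1 mul1r; lra.
have := wMLR (fun n => [set w | exists s, P n s /\ cyl s w]).
have cU : ce_opens (fun n => [set w | exists s, P n s /\ cyl s w]).
  apply: ce_opens_dec; first by apply: (cf_comp cb); computability.
  by move=> n; have [k hk] := PW n; exists (initseg w k).
move=> /(_ cU) => /(_ _)/(_ _)[] //.
  move=> n.
  apply: le_trans (_ : (nu (\bigcup_k [set w | (2 ^+ (n + c) <= path (initseg w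
    k))%R]) <= _)%E).
    apply: le_measure; rewrite ?inE.
    - have [s [_ ->]] := cU; apply: bigcup_measurable => k _; exact: measurable_cyl.
    - apply: bigcup_measurable => k _.
      exact: (measurable_initseg k (fun s => 2 ^+ (n + c) <= path s)).
    move=> v [s [Ps vs]]; exists (size s) => //=; rewrite vs.
    have := bP (n, s) 0%N; rewrite -/(P n s) Ps /= expr0 invr1 ltrBrDr => h.
    by apply: ltW; apply: lt_trans h; rewrite ltrDr.
  apply: le_trans (measure_path_ge fnu fmu rc _) _; first by rewrite exprn_gt0.
  by rewrite lee_fin exprD invfM mulrCA divff ?mulr1 // gt_eqF // exprn_gt0.
move=> n _; have [k hk] := PW n; exists (initseg w k); split=> //.
exact: cyl_initseg.
Qed.

(* Schnorr case: with [n_j] such that the expectation of [path_KL] beyond level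
   [n_j] is at most [4^-j], the clopen sets where [path_KL] grows by more than
   [2^-j] between the levels [n_j] and [n_(j+1)] have summable measures with an
   effective tail, so that their limsup is a Schnorr test. *)
Lemma SR_path_bounded w : ll_klc nu mu -> SR nu w ->
  exists C : R, forall n, path (initseg w n) <= C.
Proof.
move=> [kl ce] wSR; apply: contrapT => unb.
have {}unb (C : R) : exists n, C < path (initseg w n).
  apply: contrapT => h; apply: unb; exists C => n; rewrite leNgt; apply/negP => ?.
  by apply: h; exists n.
set e := fine (sup_KL nu mu) in ce.
have eE : sup_KL nu mu = e%:E by rewrite fineK.
have KLe := le_sup_KL eE.
have cm := creal_cylm cnu; have cu := creal_cylm cmu.
have cpath : creal path := creal_path_KL mnu mmu cm cu.
have cKL : creal (KL_upto (cylm nu) (cylm mu)) := creal_KL_upto mnu mmu cm cu.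
have {}ce A (eA : encodable A) : creal (fun _ : A => e).
  have c0 : creal (fun _ : nat => e) by exact: computable_reals_creal.
  by apply: (creal_comp (f := fun _ : A => 0%N) c0); exact: cf_cst.
(* Search for a level [j + n] at which less than [4^-j] of the expectation is missing. The margin
   [4 * 2^-(2j+3)] is half of [4^-j], so a level with less than half missing satisfies the test. *)
have [|||k [ck kP]] := @creal_search R nat _
    (fun t => 2 ^- (t.1 + t.1) - (e - KL_upto (cylm nu) (cylm mu) (t.1 + t.2)%N))
    (fun j => j + j + 3)%N.
- apply: creal_sub; first by apply: creal_exp2; computability.
  by apply: creal_sub; [exact: ce|apply: (creal_comp cKL); computability].
- by computability.
- move=> j; have e0 : 0 < 2 ^- (j + j) / 2 :> R by rewrite divr_gt0 ?exp2N_gt0.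
  have [n hn] := sup_KL_adherent eE e0.
  exists n => /=; have := KL_upto_mono mnu mmu (leq_addl j n).
  rewrite (exp2ND R (j + j) 3); have -> : 2 ^- 3 = 8%:R^-1 :> R by rewrite -natrX.
  have := exp2N_gt0 R (j + j); lra.
(* Adding [j] makes the levels unbounded; they may still fail to increase. *)
pose N j := (j + k j)%N.
have NP j : e - KL_upto (cylm nu) (cylm mu) (N j) < 2 ^- (j + j).
  have [/= h _] := kP j; rewrite /N; have := exp2N_gt0 R (j + j + 3); lra.
have cN : cfun N by rewrite /N; computability.
pose G j s := path (take (N j.+1) s) - path (take (N j) s).
have cG : creal (fun t : nat * seq bool => G t.1 t.2).
  have cN1 : cfun (fun t : nat * seq bool => N t.1) by apply: (cf_comp cN);
    computability.
  have cN2 : cfun (fun t : nat * seq bool => N t.1.+1) by apply: (cf_comp cN);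
    computability.
  by apply: creal_sub; apply: (creal_comp cpath); computability.
have [b [cb bP]] := creal_cmp cG.
(* Long enough for both levels, in either order. If [N j.+1 < N j], then [G j] is at most 0 and
   [V j] is empty. *)
pose L j := (N j + N j.+1)%N.
have cL : cfun L by apply: (cf_add cN); apply: (cf_comp cN); exact: cf_S (cf_id _).
pose p j s := b ((j, s), j).
have cp : cfun (fun t : nat * seq bool => p t.1 t.2) by apply: (cf_comp cb);
  computability.
pose V j := [set v : cantor | p j (initseg v (L j))].
have mV j : measurable (V j) by exact: (measurable_initseg (L j) (p j)).
have nuV j : (nu (V j) <= (2 ^- j)%:E)%E.
  rewrite (measure_initseg nu (L j) (p j)) lee_fin.
  have [h|h] := leqP (N j) (N j.+1); last first.
    apply: le_trans (exp2N_ge0 R j); rewrite -(mean_cst mnu (L j) 0).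
    apply: (le_mean mnu) => s sL; case E : (p j s) => //.
    have := bP (j, s) j; rewrite -/(p j s) E /G /= => h1.
    have := path_KL_take mnu mmu (N j.+1) (take (N j) s).
    rewrite take_takel 1?ltnW // -/path; have := exp2N_gt0 R j; lra.
  (* Markov's inequality: [G j] exceeds [2^-j] on [V j], and its mean is the expectation gained
     between the two levels, less than [4^-j]. *)
  apply: le_trans (_ : mean (cylm nu) (L j) (fun s => 2 ^+ j * G j s) <= _).
    apply: (le_mean mnu) => s sL.
    have G0 : 0 <= G j s.
      rewrite /G subr_ge0 -(take_takel s h); exact: path_KL_take.
    have := bP (j, s) j; rewrite -/(p j s); case: (p j s) => /= hG.
      by rewrite -ler_pdivrMl ?exprn_gt0 // mulr1 ltW.
    by rewrite mulr_ge0 // exprn_ge0.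
  rewrite meanZ meanB !(mean_take_le mnu path) ?leq_addl ?leq_addr //.
  rewrite -!KL_uptoE // -ler_pdivlMl ?exprn_gt0 // -invfM -exprD.
  by have := NP j; have := KLe (N j.+1); lra.
have WV j : V j w \/ G j (initseg w (L j)) <= 2 ^- j * 4.
  have := bP (j, initseg w (L j)) j; rewrite -/(p j (initseg w (L j))) /V /=.
  by case: (p j _) => /=; [left|right].
have path_mono n n' : (n <= n')%N -> path (initseg w n) <= path (initseg w n').
  by move=> nk; rewrite -(take_initseg w nk); exact: path_KL_take.
(* Outside [V j] the growth is at most [4 * 2^-j]; if [w] avoided these sets from [J] on, [path]
   would gain at most [8 * 2^-J] after the level [N J]. *)
have io J : exists j, (J <= j)%N /\ V j w.
  apply: contrapT => nio.
  have hG j : (J <= j)%N -> path (initseg w (N j.+1)) <= path (initseg w (N j)) +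
    2 ^- j * 4.
    move=> Jj; have [Vj|] := WV j; first by exfalso; apply: nio; exists j.
    by rewrite /G !take_initseg ?leq_addl ?leq_addr // lerBlDl.
  have hs i : path (initseg w (N (J + i)%N)) <=
      path (initseg w (N J)) + 8 * 2 ^- J - 8 * 2 ^- (J + i).
    elim: i => [|i ih]; first by rewrite addn0; lra.
    rewrite addnS; apply: le_trans (hG _ (leq_addr _ _)) _; rewrite exp2NS.
    by move: ih; lra.
  have [n] := unb (path (initseg w (N J)) + 8 * 2 ^- J).
  have nN : (n <= N (J + n)%N)%N by rewrite /N; lia.
  have := hs n; have := path_mono _ _ nN; have := exp2N_gt0 R (J + n); lra.
(* A string of length [L j] decides [V j], and [j < L j] bounds the search by the length. The strict
   [i < j] brings the measure of the union down to [2 * 2^-(i+1) = 2^-i]. *)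
pose Pt i s := has (fun j => [&& (i < j)%N,
  size s == L j & p j s]) (iota 0 (size s)).
have PtE i : [set v : cantor | exists s, Pt i s /\ cyl s v] =
    \bigcup_(j in [set j | (i.+1 <= j)%N]) V j.
  apply/seteqP; split => v /=.
    move=> [s [/hasP[j _ /and3P[ij /eqP sL ps]] vs]]; exists j => //.
    by rewrite /V /= -sL vs.
  move=> [j /= ij Vj]; exists (initseg v (L j)); split; last exact: cyl_initseg.
  apply/hasP; exists j; first by rewrite mem_iota size_initseg /L /N; lia.
  by rewrite ij size_initseg eqxx.
have cPt : cfun (fun t : nat * seq bool => Pt t.1 t.2).
  apply: (cf_has (P := fun t j => [&& (t.1 < j)%N, size t.2 == L j & p j t.2])
    (n := fun t : nat * seq bool => size t.2)); last by computability.
  have c1 : cfun (fun t : nat * seq bool * nat => L t.2) by apply: (cf_comp cL);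
    computability.
  have c2 : cfun (fun t : nat * seq bool * nat => p t.2 t.1.2).
    by apply: (cf_op2 (h := p) cp); computability.
  by computability.
have Wi i : exists j, (i < j)%N /\ V j w by exact: (io i.+1).
have ceU : ce_opens (fun i => [set v : cantor | exists s, Pt i s /\ cyl s v]).
  apply: ce_opens_dec => // i; have [j [ij Vj]] := Wi i.
  have : (\bigcup_(j in [set j | (i.+1 <= j)%N]) V j) w by exists j.
  by rewrite -PtE => -[s [Ps _]]; exists s.
have mU i : measurable (\bigcup_(j in [set j | (i.+1 <= j)%N]) V j).
  by apply: bigcup_measurable.
have /= := wSR _ ceU; apply.
- move=> i; rewrite PtE; apply: le_trans (measure_bigcup_tail _ mV nuV) _.
  by rewrite lee_fin exp2NS mulrC divfK.
- apply: (@creal_computable_reals _ nat _ _ id) => //.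
  (* The union of the [V j] with [i < j < M] is determined by the first [La M] bits, so its measure
     is a computable mean; the sets from [M] on add at most [2 * 2^-M]. *)
  pose La M := (\sum_(j < M) L j)%N.
  have LLa j M : (j < M)%N -> (L j <= La M)%N.
    by move=> jM; rewrite /La (bigD1 (Ordinal jM)) //= leq_addr.
  have cLa : cfun La.
    by apply: (cf_sum (F := fun _ j => L j)); [apply: (cf_comp cL)|]; computability.
  pose pM i M s := has (fun j => (i < j)%N && p j (take (L j) s)) (iota 0 M).
  have cpM : cfun (fun t : nat * nat * seq bool => pM t.1.1 t.1.2 t.2).
    apply: (cf_has (P := fun t j => (t.1.1 < j)%N && p j (take (L j) t.2))
      (n := fun t : nat * nat * seq bool => t.1.2)); last by computability.
    have c1 : cfun (fun t : nat * nat * seq bool * nat => L t.2) by apply: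
      (cf_comp cL); computability.
    have c2 : cfun (fun t : nat * nat * seq bool * nat => p t.2 (take (L t.2)
      t.1.2)).
      by apply: (cf_op2 (h := p) cp); computability.
    by computability.
  have pME i M : [set v : cantor | pM i M (initseg v (La M))] =
      \bigcup_(j in [set j | (i < j < M)%N]) V j.
    apply/seteqP; split => v /=.
      move=> /hasP[j]; rewrite mem_iota /= add0n => jM /andP[ij].
      by rewrite take_initseg ?LLa // => pj; exists j => //=; rewrite ij.
    move=> [j /= /andP[ij jM] Vj]; apply/hasP; exists j; first by rewrite mem_iota.
    by rewrite ij take_initseg ?LLa.
  apply: (@creal_lim _ _ _ _ (fun=> 2%N) (fun t => mean (cylm nu) (La t.2) (fun s
    => (pM t.1 t.2 s)%:R))).
  + by computability.
  + apply: (creal_mean (f := fun t : nat * nat * seq bool => (pM t.1.1 t.1.2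
    t.2)%:R) cm).
      by apply: creal_nat; computability.
    by apply: (cf_comp cLa); computability.
  + move=> i M /=; rewrite PtE.
    have := measure_initseg nu (La M) (pM i M); rewrite pME => WE.
    have tail := measure_bigcup_tail M mV nuV.
    have mW : measurable (\bigcup_(j in [set j | (i < j < M)%N]) V j) by apply:
      bigcup_measurable.
    have mT : measurable (\bigcup_(j in [set j | (M <= j)%N]) V j) by apply:
      bigcup_measurable.
    have l1 : (nu (\bigcup_(j in [set j | (i < j < M)%N]) V j) <=
        nu (\bigcup_(j in [set j | (i.+1 <= j)%N]) V j))%E.
      apply: le_measure; rewrite ?inE //.
      by move=> v [j /= /andP[ij _] Vj]; exists j.
    have l2 : (nu (\bigcup_(j in [set j | (i.+1 <= j)%N]) V j) <=
        nu (\bigcup_(j in [set j | (i < j < M)%N]) V j) +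
        nu (\bigcup_(j in [set j | (M <= j)%N]) V j))%E.
      apply: le_trans (measureU2 _ mW mT); apply: le_measure; rewrite ?inE //.
        exact: measurableU.
      move=> v [j /= ij Vj]; have [Mj|jM] := leqP M j; first by right; exists j.
      by left; exists j => //=; rewrite ij.
    rewrite WE in l1 l2.
    have l3 := le_trans l2 (leeD2l _ tail).
    rewrite -[X in (X <= _)%E]fineK ?fin_num_measure // -EFinD lee_fin in l3.
    rewrite -[X in (_ <= X)%E]fineK ?fin_num_measure // lee_fin in l1.
    by rewrite ger0_norm ?subr_ge0 // lerBlDl.
- move=> i _ /=; have [j [ij Vj]] := Wi i.
  have : (\bigcup_(j in [set j | (i.+1 <= j)%N]) V j) w by exists j.
  by rewrite -PtE.
Qed.

End random_bounded.

(** * The measure associated with a test *)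

Section counting.
Variable t : nat -> nat -> seq bool.

(** Equality with [take] forces [t i j] to be a prefix of [s], so a hit is certified by [s] for all
    its extensions. *)
Definition hit k i s := has (fun j => take (size (t i j)) s == t i j) (iota 0 k).

Definition hits s := (\sum_(i < size s) hit (size s) i s)%N.

(** The empty string is its own parent, hence never flagged. Several simultaneous hits give one
    flag. *)
Definition new_hit s := (hits (parent s) < hits s)%N.

Lemma hitP k i s w : cyl s w -> hit k i s -> exists2 j, (j < k)%N & cyl (t i j) w.
Proof.
move=> ws /hasP[j]; rewrite mem_iota /= add0n => jk /eqP h; exists j => //.
by rewrite -h; exact: cyl_take.
Qed.

Lemma hit_initseg k i n j w : (j < k)%N -> (size (t i j) <= n)%N -> cyl (t i j) w ->
  hit k i (initseg w n).
Proof.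
move=> jk sn wt; apply/hasP; exists j; first by rewrite mem_iota.
by rewrite take_initseg //; apply/eqP/cylE.
Qed.

Lemma hit_rcons k i s b : hit k i s -> hit k.+1 i (rcons s b).
Proof.
move=> /hasP[j]; rewrite mem_iota /= add0n => jk /eqP h.
apply/hasP; exists j; first by rewrite mem_iota /= add0n ltnW.
rewrite -cats1 takel_cat ?h //.
by move/(congr1 size): h; rewrite size_take_min => <-; rewrite geq_minr.
Qed.

Lemma hits_rcons s b : (hits s <= hits (rcons s b))%N.
Proof.
rewrite /hits size_rcons big_ord_recr /=; apply: leq_trans (leq_addr _ _).
apply: leq_sum => i _; case: (boolP (hit (size s) i s)) => // h.
by rewrite hit_rcons.
Qed.

Lemma hits_parent s : (hits (parent s) <= hits s)%N.
Proof. by case/lastP: s => // s b; rewrite parent_rcons hits_rcons. Qed.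

Lemma hits_take n s : (hits (take n s) <= hits s)%N.
Proof.
elim/last_ind: s => // s b ih; have [h|h] := leqP n (size s).
  by rewrite -cats1 takel_cat // cats1 (leq_trans ih) // hits_rcons.
by rewrite take_oversize // size_rcons.
Qed.

Hypothesis ct : cfun (fun x : nat * nat => t x.1 x.2).

Lemma cf_hit : cfun (fun x : nat * nat * seq bool => hit x.1.1 x.1.2 x.2).
Proof.
apply: (cf_has (P := fun (x : nat * nat * seq bool) j =>
  take (size (t x.1.2 j)) x.2 == t x.1.2 j) (n := fun x => x.1.1));
    last by computability.
have c1 : cfun (fun x : nat * nat * seq bool * nat => t x.1.1.2 x.2).
  by apply: (cf_op2 (h := t) ct); computability.
by computability.
Qed.

Lemma cf_hits : cfun hits.
Proof.
apply: (cf_sum (F := fun s i => hit (size s) i s : nat)); last by computability.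
apply: cf_nat.
by apply: (cf_comp (f := fun x : seq bool * nat => (size x.1, x.2, x.1)) cf_hit);
  computability.
Qed.

Lemma cf_new_hit : cfun new_hit.
Proof.
have c1 := cf_hits.
by apply: cf_ltn => //; apply: (cf_comp c1); apply: cf_parent; computability.
Qed.

Lemma hits_unbounded w : (forall i, exists j, cyl (t i j) w) ->
  forall N, exists n, (N <= hits (initseg w n))%N.
Proof.
move=> /choice[j wj] N.
(* This stage exceeds the index and the length of a cylinder around [w] for each [i < N], and it is
   at least [N], so that these [i] are counted. *)
pose n := (N + \sum_(i < N) (j i + size (t i (j i))).+1)%N.
have jn (i : 'I_N) : (j i + size (t i (j i)) < n)%N.
  by rewrite /n (bigD1 i) //= addSn addnS ltnS addnCA leq_addr.
exists n; rewrite /hits size_initseg.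
rewrite -(big_mkord predT (fun i => hit n i (initseg w n) : nat)).
rewrite (@big_cat_nat _ _ _ N) ?leq_addr //= big_mkord.
apply: leq_trans (leq_addr _ _).
rewrite -[leqLHS]card_ord -sum1_card; apply: leq_sum => i _.
by rewrite (hit_initseg (j := j i)) //; have := jn i; lia.
Qed.

End counting.

(** * Reweighted transition probabilities *)

Section reweighting.
Context (R : realType) (m : seq bool -> R) (mm : mass m) (cm : creal m).
Context (flag : pred (seq bool)) (cflag : cfun (fun s => flag s : bool)).

Definition cond1 s := m (rcons s true) / m s.

Lemma cond1_gt0 s : 0 < cond1 s.
Proof. by rewrite divr_gt0 ?mass_gt0. Qed.

Lemma cond1_lt1 s : cond1 s < 1.
Proof.
by rewrite ltr_pdivrMr ?mass_gt0 // mul1r (massD mm s) ltrDr mass_gt0.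
Qed.

Lemma cond0E s : m (rcons s false) / m s = 1 - cond1 s.
Proof.
rewrite /cond1 -(divff (mass_neq0 mm s)) -mulrBl; congr (_ / _).
by rewrite (massD mm s) addrK.
Qed.

(** With [p = cond1 s], the search for [N p - 5] at precision 0 stops with [N p > 6]. Its
    predecessor failed, so [(N - 1) p <= 9], and [p < 1] gives the upper bound 10. The search
    succeeds because [N p > 9] for large [N]. *)
Lemma exists_halvings : exists N : seq bool -> nat, cfun N /\
  forall s, 6 < (N s)%:R * cond1 s <= 10.
Proof.
have cc := creal_cond mm cm true.
have [|||N [cN NP]] := @creal_search R (seq bool) _
  (fun x => x.2%:R * cond1 x.1 - 5%:R) (fun=> 0%N).
- apply: creal_sub; last by apply: creal_nat; computability.
  by apply: creal_mul; [apply: creal_nat; computability|apply: (creal_comp cc);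
    computability].
- by computability.
- move=> s; exists (Num.truncn (9 / cond1 s)).+1 => /=.
  have := truncnS_gt (9 / cond1 s); rewrite ltr_pdivrMr ?cond1_gt0 //.
  by rewrite expr0 invr1; lra.
exists N; split=> // s; have [/= h1 h2] := NP s; rewrite expr0 invr1 in h1 h2.
apply/andP; split; first by lra.
case E : (N s) h1 h2 => [|k] /= h1 h2; first by rewrite mul0r.
have /= := h2 k (ltnSn _);
  rewrite -[k.+1%:R]natr1 [_ * cond1 s in X in _ -> X]mulrDl mul1r;
    have := cond1_lt1 s; lra.
Qed.

Variables (N : seq bool -> nat) (cN : cfun N).
Hypothesis NP : forall s, 6 < (N s)%:R * cond1 s <= 10.

Definition new_cond1 s := if flag s then cond1 s * 2 ^- N s else cond1 s.

Definition new_cond s (b : bool) := if b then new_cond1 s else 1 - new_cond1 s.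

(** The bit at position [j] is written as the last one of a prefix, which keeps to string operations
    already known to be computable. *)
Definition reweight s := \prod_(j < size s) new_cond (take j s) (last false (take
  j.+1 s)).

Lemma new_cond1_gt0 s : 0 < new_cond1 s.
Proof.
rewrite /new_cond1; case: ifP => _; last exact: cond1_gt0.
by apply: mulr_gt0; [exact: cond1_gt0|exact: exp2N_gt0].
Qed.

Lemma new_cond1_le s : new_cond1 s <= cond1 s.
Proof.
rewrite /new_cond1; case: ifP => // _; rewrite ler_piMr ?(ltW (cond1_gt0 s)) //.
by have := exp2N_le R (leq0n (N s)); rewrite expr0 invr1.
Qed.

Lemma new_cond_gt0 s b : 0 < new_cond s b.
Proof.
case: b => /=; first exact: new_cond1_gt0.
by rewrite subr_gt0; apply: le_lt_trans (new_cond1_le s) (cond1_lt1 s).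
Qed.

Lemma reweight_rcons s b : reweight (rcons s b) = reweight s * new_cond s b.
Proof.
rewrite /reweight size_rcons big_ord_recr /=; congr (_ * new_cond _ _).
- by apply: eq_bigr => j _; rewrite -cats1 !takel_cat // ltnW.
- by rewrite -cats1 take_size_cat.
- by rewrite take_oversize ?size_rcons // last_rcons.
Qed.

Lemma mass_reweight : mass reweight.
Proof.
split=> [|s|s]; first by rewrite /reweight big_ord0.
  by apply: prodr_gt0 => j _; exact: new_cond_gt0.
by rewrite !reweight_rcons -mulrDr /= subrK mulr1.
Qed.

Lemma creal_reweight : creal reweight.
Proof.
have cc : creal cond1 := creal_cond mm cm true.
have c1 : creal new_cond1.
  by apply: creal_if => //; apply: creal_mul => //; apply: creal_exp2.
have c2 : creal (fun x : seq bool * bool => new_cond x.1 x.2).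
  have c3 : creal (fun x : seq bool * bool => new_cond1 x.1) by apply:
    (creal_comp c1); computability.
  apply: creal_if => //; first by computability.
  by apply: creal_sub => //; apply: (@creal_nat R _ _ (fun=> 1%N)); computability.
apply: (creal_prod (x := fun x : seq bool * nat =>
  new_cond (take x.2 x.1) (last false (take x.2.+1 x.1)))); last by computability.
- move=> [s j] /=; rewrite (ltW (new_cond_gt0 _ _)) /=.
  case: (last _ _) => /=.
    by apply: le_trans (new_cond1_le _) (ltW (cond1_lt1 _)).
  by rewrite gerBl ltW // new_cond1_gt0.
- apply: (creal_comp (f := fun x : seq bool * nat =>
    (take x.2 x.1, last false (take x.2.+1 x.1))) c2); computability.
Qed.

Lemma reweight_condE s b : reweight (rcons s b) / reweight s = new_cond s b.
Proof. by rewrite reweight_rcons mulrAC divff ?mul1r // mass_neq0 //;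
  exact: mass_reweight. Qed.

Lemma step_KL_reweightE s : step_KL m reweight s =
  (1 - cond1 s) * ln ((1 - cond1 s) / (1 - new_cond1 s)) +
  cond1 s * ln (cond1 s / new_cond1 s).
Proof. by rewrite /step_KL /step_KL_term !reweight_condE cond0E. Qed.

Lemma step_KL_unflagged s : ~~ flag s -> step_KL m reweight s = 0.
Proof.
move=> /negbTE fs; rewrite step_KL_reweightE /new_cond1 fs !divff ?ln1 ?mulr0
  ?addr0 //.
  by rewrite gt_eqF // cond1_gt0.
by rewrite subr_eq0 eq_sym lt_eqF // cond1_lt1.
Qed.

Lemma ln2_bounds : 2^-1 <= ln (2 : R) <= 1.
Proof.
apply/andP; split.
  by apply: le_trans (ln_ge_sub (_ : 0 < 2)); lra.
by have := @le_ln1Dx R 1; rewrite (_ : 1 + 1 = 2) //; apply; lra.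
Qed.

(* With [p = cond1 s] and [N = N s], the divergence is
   [p N ln 2 + (1 - p) ln ((1 - p) / (1 - p 2^-N))]; the first summand lies in
   [3, 10] because [6 < N p <= 10], the second one in [-1, 0]. *)
Lemma step_KL_flagged s : flag s -> 2 <= step_KL m reweight s <= 10.
Proof.
move=> fs; rewrite step_KL_reweightE /new_cond1 fs.
have p0 := cond1_gt0 s; have p1 := cond1_lt1 s; have /andP[N1 N2] := NP s.
have /andP[l1 l2] := ln2_bounds.
have -> : cond1 s / (cond1 s * 2 ^- N s) = 2 ^+ N s.
  by rewrite invfM invrK mulrA divff ?mul1r // gt_eqF.
rewrite lnXn // -[ln 2 *+ N s]mulr_natl (mulrA (cond1 s)) (mulrC (cond1 s) (N
  s)%:R).
have e0 := exp2N_gt0 R (N s).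
have e1 : 2 ^- N s <= 1 :> R by have := exp2N_le R (leq0n (N s));
  rewrite expr0 invr1.
move: (cond1 s) (2 ^- N s) p0 p1 N1 N2 e0 e1 => p e p0 p1 N1 N2 e0 e1.
have pe0 : 0 < p * e by rewrite mulr_gt0.
have pep : p * e <= p by rewrite ler_piMr // ltW.
set X := (1 - p) * ln _.
have X0 : X <= 0.
  rewrite /X pmulr_rle0 ?subr_gt0 //; apply: ln_le0.
  by rewrite ler_pdivrMr; lra.
have X1 : -1 <= X.
  apply: le_trans (_ : (1 - p) * (1 - ((1 - p) / (1 - p * e))^-1) <= _).
    have -> : (1 - p) * (1 - ((1 - p) / (1 - p * e))^-1) = p * e - p.
      by field; apply/andP; split; rewrite gt_eqF //; lra.
    by lra.
  apply: ler_wpM2l; first by rewrite subr_ge0 ltW.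
  by apply: ln_ge_sub; apply: divr_gt0; lra.
have h : (N s)%:R * p * 2^-1 <= (N s)%:R * p * ln 2.
  by rewrite ler_wpM2l //; lra.
have h' : (N s)%:R * p * ln 2 <= (N s)%:R * p.
  by rewrite ler_piMr //; lra.
by apply/andP; split; lra.
Qed.

End reweighting.

(** * Expected number of hits and divergence of the reweighted measure *)

Section test_to_measure.
Context (R : realType) (nu : probability cantor R).
Hypotheses (cnu : computable_measure nu) (fnu : full_support nu).
Variable t : nat -> nat -> seq bool.
Hypothesis ct : cfun (fun x : nat * nat => t x.1 x.2).
Let U n := \bigcup_k cyl (t n k).
Hypothesis hU : forall n, (nu (U n) <= (2 ^- n)%:E)%E.

Let m := cylm nu.
Let mm : mass m := mass_cylm fnu.
Let cm : creal m := creal_cylm cnu.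
Let v n := fine (nu (U n)).
Let S_ n := \sum_(i < n) v i.
Let mhits n := mean m n (fun s => (hits t s)%:R).

Let mU n : measurable (U n).
Proof. by apply: bigcup_measurable => k _; exact: measurable_cyl. Qed.

Let vE n : nu (U n) = (v n)%:E.
Proof. by rewrite fineK // fin_num_measure. Qed.

Let v_ge0 n : 0 <= v n. Proof. by rewrite fine_ge0. Qed.

Let v_le n : v n <= 2 ^- n. Proof. by rewrite -lee_fin -vE. Qed.

Let hit_set n i := [set w : cantor | hit t n i (initseg w n)].

Let hit_setE n i : nu (hit_set n i) = (mean m n (fun s => (hit t n i s)%:R))%:E.
Proof. exact: measure_initseg. Qed.

Let mhit_set n i : measurable (hit_set n i).
Proof. exact: measurable_initseg. Qed.

Let hit_set_sub n i : hit_set n i `<=` U i.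
Proof.
by move=> w /(hitP (cyl_initseg w n))[j _ wj]; exists j.
Qed.

Let mean_hit_le n i : mean m n (fun s => (hit t n i s)%:R) <= v i.
Proof.
rewrite -lee_fin -hit_setE -vE; by apply: le_measure; rewrite ?inE //;
  exact: hit_set_sub.
Qed.

Let mean_hitsE n : mhits n = \sum_(i < n) mean m n (fun s => (hit t n i s)%:R).
Proof.
rewrite -mean_sum; apply: eq_mean => s sn.
by rewrite /hits sn natr_sum.
Qed.

Let S_S n : S_ n.+1 = S_ n + v n.
Proof. by rewrite /S_ big_ord_recr. Qed.

Let S_mono n k : (n <= k)%N -> S_ n <= S_ k.
Proof.
move=> /subnKC <-; elim: (k - n)%N => [|j ih]; first by rewrite addn0.
by rewrite addnS S_S; apply: le_trans ih _; rewrite lerDl.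
Qed.

Let S_le n k : S_ k <= S_ n + 2 * 2 ^- n.
Proof.
have [kn|/ltnW/subnKC <-] := leqP k n.
  by apply: le_trans (S_mono kn) _; rewrite lerDl mulr_ge0 // exp2N_ge0.
apply: le_trans (_ : S_ n + 2 * 2 ^- n - 2 * 2 ^- (n + (k - n)) <= _); last first.
  by rewrite gerBl mulr_ge0 // exp2N_ge0.
elim: (k - n)%N => [|j ih]; first by rewrite addn0 addrK.
rewrite addnS S_S exp2NS; have := v_le (n + j); move: ih; lra.
Qed.

(** The sum of all the [nu (U n)]; the test bounds give its partial sums an explicit rate of
    convergence. *)
Let S := sup (range S_).

Let S_ub n : S_ n <= S.
Proof.
apply: ub_le_sup; last by exists n.
by exists (S_ 0 + 2 * 2 ^- 0) => _ [k _ <-].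
Qed.

Let S_lb n : S <= S_ n + 2 * 2 ^- n.
Proof. by apply: ge_sup; [exists (S_ 0), 0%N|move=> _ [k _ <-]]. Qed.

Let mhits_le n : mhits n <= S.
Proof.
apply: le_trans (S_ub n); rewrite mean_hitsE; apply: ler_sum => i _.
exact: mean_hit_le.
Qed.

Let S_le2 : S <= 2.
Proof. by have := S_lb 0; rewrite /S_ big_ord0 expr0 invr1 mulr1 add0r. Qed.

Let hit_set_mono i n k : (n <= k)%N -> hit_set n i `<=` hit_set k i.
Proof.
move=> /subnKC <-; elim: (k - n)%N => [|j ih]; first by rewrite addn0.
apply: subset_trans ih _ => w; rewrite addnS /hit_set /= initsegS; exact: hit_rcons.
Qed.

(** Continuity from below: the hit sets of index [i] increase to [U i]. *)
Let mean_hit_cvg i (e : R) : 0 < e ->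
  exists n, forall k, (n <= k)%N -> v i - e < mean m k (fun s => (hit t k i s)%:R).
Proof.
move=> e0.
have cv : nu (hit_set n i) @[n --> \oo] --> nu (\bigcup_n hit_set n i).
  apply: nondecreasing_cvg_mu => //; first by apply: bigcup_measurable.
  by move=> n k nk; apply/subsetPset; exact: hit_set_mono.
have UE : \bigcup_n hit_set n i = U i.
  apply/seteqP; split => w; first by move=> [n _]; exact: hit_set_sub.
  move=> [j _ wj]; exists (maxn j.+1 (size (t i j))) => //.
  by apply: (hit_initseg (j := j)) => //; rewrite ?leq_maxl ?leq_maxr.
rewrite UE vE in cv.
apply: contrapT => nex.
have le n : (nu (hit_set n i) <= (v i - e)%:E)%E.
  rewrite hit_setE lee_fin leNgt; apply/negP => h; apply: nex; exists n => k nk.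
  apply: lt_le_trans h _; rewrite -lee_fin -!hit_setE.
  by apply: le_measure; rewrite ?inE //; exact: hit_set_mono.
have : ((v i)%:E <= (v i - e)%:E)%E.
  rewrite -(cvg_lim _ cv) //; apply: lime_le; first by apply/cvg_ex; eexists;
    exact: cv.
  exact: nearW.
by rewrite lee_fin => h; move: e0; lra.
Qed.

Let partial_cvg I (e : R) : 0 < e -> exists n, forall k, (n <= k)%N ->
  S_ I - e < \sum_(i < I) mean m k (fun s => (hit t k i s)%:R).
Proof.
elim: I e => [|I ih] e e0.
  by exists 0%N => k _; rewrite /S_ !big_ord0 sub0r oppr_lt0.
have e2 : 0 < e / 2 by rewrite divr_gt0.
have [n1 h1] := ih _ e2; have [n2 h2] := mean_hit_cvg I e2.
exists (maxn n1 n2) => k; rewrite geq_max => /andP[/h1 {}h1 /h2 {}h2].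
rewrite S_S big_ord_recr /=; lra.
Qed.

(** The sets of index at least [I] contribute at most [2 * 2^-I] to [S], and the finitely many
    others are handled by [partial_cvg]. No rate results, since it depends on the speed at which the
    cylinders exhaust the open sets. *)
Let mhits_cvg (e : R) : 0 < e -> exists n, S - mhits n < e.
Proof.
move=> e0; have e4 : 0 < e / 4 by rewrite divr_gt0.
have [I hI] := exp2N_small e4; have e2 : 0 < e / 2 by rewrite divr_gt0.
have [n hn] := partial_cvg I e2; exists (maxn n I).
have := hn _ (leq_maxl n I); have := S_lb I.
rewrite mean_hitsE; set k := maxn n I => h1 h2.
have : \sum_(i < I) mean m k (fun s => (hit t k i s)%:R) <=
    \sum_(i < k) mean m k (fun s => (hit t k i s)%:R).
  rewrite -(big_mkord predT (fun i => mean m k (fun s => (hit t k i s)%:R))).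
  rewrite -(big_mkord predT (fun i => mean m k (fun s => (hit t k i s)%:R))) /=.
  rewrite [leRHS](@big_cat_nat _ _ _ I) ?leq_maxr //= lerDl.
  by apply: sumr_ge0 => i _; apply: (mean_ge0 mm).
lra.
Qed.

Let creal_S : computable_reals id v -> forall A (eA : encodable A),
  creal (fun _ : A => S).
Proof.
move=> cv A eA.
have cv' : creal v by exact: computable_reals_creal.
have cS_ : creal S_.
  by apply: (creal_sum (x := fun x : nat * nat => v x.2));
    [apply: (creal_comp cv')|]; computability.
apply: (@creal_lim _ _ _ _ (fun=> 2%N) (fun x => S_ x.2));
  [by computability|by apply: (creal_comp cS_); computability|].
by move=> _ n /=; rewrite ger0_norm ?subr_ge0 ?S_ub // lerBlDl S_lb.
Qed.

Let creal_mhits : creal mhits.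
Proof.
have ch := cf_hits ct.
apply: (creal_mean (f := fun x : nat * seq bool => (hits t x.2)%:R) cm);
  last by computability.
by apply: creal_nat; apply: (cf_comp ch); computability.
Qed.

(** The last clause is all that the estimates below use of the construction. *)
Lemma reweighted_measure : exists mu : probability cantor R,
  [/\ computable_measure mu, full_support mu &
    forall s, if new_hit t s then (2 <= step_KL m (cylm mu) s <= 10 : Prop)
              else step_KL m (cylm mu) s = 0].
Proof.
have [N [cN NP]] := exists_halvings mm cm.
have mu_mass := mass_reweight mm (new_hit t) N.
have [mu muE] := mass_probability mu_mass.
have msmu : cylm mu = reweight m (new_hit t) N.
  by apply/funext => s; rewrite /cylm muE.
exists mu; split=> [|s|s].
- have : creal (cylm mu).
    by rewrite msmu; apply: creal_reweight => //; exact: cf_new_hit.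
  exact: (creal_computable_reals strnK str_codeK).
- by rewrite muE lte_fin mass_gt0.
- rewrite msmu; case: ifPn => h; first exact: step_KL_flagged.
  exact: step_KL_unflagged.
Qed.

Section reweighted.
Variable mu : probability cantor R.
Hypotheses (cmu : computable_measure mu) (fmu : full_support mu).
Hypothesis stepP : forall s,
  if new_hit t s then (2 <= step_KL m (cylm mu) s <= 10 : Prop)
              else step_KL m (cylm mu) s = 0.
Let u := cylm mu.
Let mmu : mass u := mass_cylm fmu.

Let step_le s : step_KL m u s <= 10 * ((hits t s)%:R - (hits t (parent s))%:R).
Proof.
have := stepP s; rewrite /new_hit; case: ltnP => h.
  move=> /andP[_ h1]; apply: le_trans h1 _; rewrite ler_peMr // lerBrDl natr1.
  by rewrite ler_nat.
by move=> ->; rewrite mulr_ge0 // subr_ge0 ler_nat hits_parent.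
Qed.

(** The shift of indices: a hit new at length [n + 1] changes the transition out of that string,
    which enters the divergence at level [n + 2]. *)
Let KL_upto_step n : KL_upto m u n.+2 - KL_upto m u n.+1 <= 10 * (mhits n.+1 -
  mhits n).
Proof.
rewrite !KL_uptoE // mean_path_KL_S // addrAC subrr add0r.
rewrite /mhits -[mean m n _](mean_S mm) -meanB -meanZ;
  apply: (le_mean mm) => s _; exact: step_le.
Qed.

Let KL_upto1 : KL_upto m u 1 = 0.
Proof.
rewrite KL_uptoE // mean_path_KL_S // /mean /= !big_seq1 path_KL_nil mulr0 add0r.
have -> : step_KL m u [::] = 0; last by rewrite mulr0.
by have := stepP [::]; rewrite /new_hit /= ltnn.
Qed.

Let KL_upto_diff n k : (n <= k)%N ->
  KL_upto m u k.+1 - KL_upto m u n.+1 <= 10 * (mhits k - mhits n).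
Proof.
move=> /subnKC <-; elim: (k - n)%N => [|j ih]; first by rewrite addn0 !subrr mulr0.
by rewrite addnS; have := KL_upto_step (n + j); move: ih; lra.
Qed.

Let mhits_ge0 n : 0 <= mhits n.
Proof. by apply: (mean_ge0 mm). Qed.

(** The divergence still to come is paid for by the hits still to come. The case [n = 0] gives the
    uniform bound, large [n] an error estimate for the supremum. *)
Let KL_upto_le n k : KL_upto m u k <= KL_upto m u n.+1 + 10 * (S - mhits n).
Proof.
have [kn|] := leqP k n.+1.
  apply: le_trans (KL_upto_mono mm mmu kn) _.
  by rewrite lerDl mulr_ge0 // subr_ge0 mhits_le.
case: k => // k; rewrite ltnS => nk; have := KL_upto_diff (ltnW nk).
by have := mhits_le k; lra.
Qed.

Let KL_upto_le20 k : KL_upto m u k <= 20.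
Proof.
apply: le_trans (KL_upto_le 0 k) _; rewrite KL_upto1 add0r.
by have := mhits_ge0 0; have := S_le2; lra.
Qed.

Lemma reweighted_kl : ll_kl nu mu.
Proof. exact: sup_KL_bounded KL_upto_le20. Qed.

Lemma reweighted_klc : computable_reals id v -> ll_klc nu mu.
Proof.
move=> cv; split; first exact: reweighted_kl.
set e := fine _; have eE : sup_KL nu mu = e%:E by rewrite fineK //;
  exact: reweighted_kl.
have cS := creal_S cv.
apply: (@creal_computable_reals _ nat _ _ id) => //.
have cKL := creal_KL_upto mm mmu cm (creal_cylm cmu).
have cS1 := cS (nat * nat)%type _; have ch := creal_mhits.
(* The error [10 (S - mhits n)] is computable because [S] is, and it becomes arbitrarily small at no
   known rate, so the index is found by search. *)
apply: (creal_lim_search (y := fun x : nat * nat => KL_upto m u x.2.+1)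
  (b := fun x => 10%:R * (S - mhits x.2))).
- by apply: (creal_comp cKL); computability.
- apply: creal_mul; first by apply: creal_nat; computability.
  by apply: creal_sub => //; apply: (creal_comp ch); computability.
- move=> i n /=; rewrite ger0_norm ?subr_ge0; last exact: le_sup_KL eE _.
  rewrite lerBlDl -lee_fin -eE sup_KLE.
  by apply: ge_ereal_sup => _ [k _ <-]; rewrite lee_fin; exact: KL_upto_le.
- move=> i d d0; have [|n hn] := @mhits_cvg (d / 10); first by rewrite divr_gt0.
  by exists n => /=; lra.
Qed.

(** Beyond any level [hits] increases again along [w], so some later prefix is flagged and adds a
    divergence of at least 2. *)
Lemma reweighted_unbounded w : (forall n, U n w) ->
  forall C : R, exists n, C < path_KL m u (initseg w n).
Proof.
move=> wU.
have hun : forall N, exists n, (N <= hits t (initseg w n))%N.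
  by apply: hits_unbounded => i; have [j _ wj] := wU i; exists j.
have path_mono n k : (n <= k)%N -> path_KL m u (initseg w n) <= path_KL m u
  (initseg w k).
  by move=> nk; rewrite -(take_initseg w nk); exact: path_KL_take.
have jump n k : (n <= k)%N -> (hits t (initseg w n) < hits t (initseg w k))%N ->
    exists2 j, (n <= j)%N & new_hit t (initseg w j.+1).
  elim: k => [|k ih]; first by rewrite leqn0 => /eqP ->; rewrite ltnn.
  rewrite leq_eqVlt => /predU1P[->|]; first by rewrite ltnn.
  rewrite ltnS => nk h.
  have [h1|h1] := ltnP (hits t (initseg w n)) (hits t (initseg w k));
    first exact: ih.
  exists k => //; rewrite /new_hit parent_initseg; exact: leq_ltn_trans h1 h.
have step N : exists n, N%:R <= path_KL m u (initseg w n).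
  elim: N => [|N [n hn]]; first by exists 0%N; exact: path_KL_ge0.
  have [k hk] := hun (hits t (initseg w n)).+1.
  have nk : (n <= k)%N.
    rewrite leqNgt; apply/negP => /ltnW kn; move: hk.
    by rewrite ltnNge -(take_initseg w kn) hits_take.
  have [j nj jn] := jump _ _ nk hk.
  (* The divergence at the flagged prefix of length [j + 1] is counted from length [j + 2] on. *)
  exists j.+2; rewrite initsegS path_KL_rcons -natr1; apply: lerD.
    by apply: le_trans hn _; apply: path_mono; rewrite leqW.
  by have := stepP (initseg w j.+1); rewrite jn => /andP[h _]; apply: le_trans h;
    lra.
move=> C; have [n hn] := step (Num.truncn C).+1; exists n.
exact: lt_le_trans (truncnS_gt C) hn.
Qed.

End reweighted.
End test_to_measure.

Theorem theorem1p11 (R : realType) (nu : probability cantor R) :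
  computable_measure nu -> full_support nu ->
  MLR nu = MR1 (@ll_kl R) nu /\ SR nu = MR1 (@ll_klc R) nu.
Proof.
move=> cnu fnu.
(* One measure refutes membership in both classes: [ll_kl] holds for any test, [ll_klc] when its
   measures are computable. *)
have refute (w : cantor) U : ce_opens U -> (forall n,
  (nu (U n) <= (2 ^- n)%:E)%E) ->
    (\bigcap_n U n) w -> exists mu, [/\ computable_measure mu, full_support mu,
      ll_kl nu mu, (computable_reals id (fun n => fine (nu (U n))) -> ll_klc nu
        mu) &
      ~ (\sum_(0 <= n <oo) condKL n nu mu w < +oo)%E].
  move=> [t [/cfun_computable2 ct UE]].
  have -> : U = fun n => \bigcup_k cyl (t n k) by apply/funext.
  move=> hU wU.
  have [mu [cmu fmu stepP]] := reweighted_measure cnu fnu ct.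
  exists mu; split=> //.
  - exact: reweighted_kl stepP.
  - exact: reweighted_klc stepP.
  - move=> /condKL_summable[] // C hC.
    have [|n] := reweighted_unbounded fnu fmu stepP (w := w) _ C;
      first by move=> n; exact: wU.
    by rewrite ltNge hC.
split; apply/seteqP; split => w.
- move=> wMLR mu cmu fmu kl; apply/condKL_summable => //.
  exact: MLR_path_bounded.
- move=> wMR U cU hU wU.
  have [mu [cmu fmu kl _]] := refute w U cU hU wU; apply; exact: wMR.
- move=> wSR mu cmu fmu kl; apply/condKL_summable => //.
  exact: SR_path_bounded.
- move=> wMR U cU hU cv wU.
  have [mu [cmu fmu _ klc]] := refute w U cU hU wU; apply; apply: wMR => //;
    exact: klc.
Qed.
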